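(* For every $\alpha\in(0,1)$, $\mathrm{DIM}^\alpha=\{A\in\mathbf C:\dim(A)=\alpha\}$ is Wadge complete for $\boldsymbol\Pi^0_3$. Therefore it is not a $\boldsymbol\Sigma^0_3$-class, and in particular it is not a $\Sigma^0_3$-class.
   Context: $\mathbf{C}=\{0,1\}^{\mathbb N}$; $A\upharpoonright n$ is the first $n$ bits of $A$. $\dim(A)$ is the constructive dimension: the infimum of $s$ such that some lower semicomputable $s$-gale $d$ (i.e. $d:\{0,1\}^*\to[0,\infty)$ with $2^sd(w)=d(w0)+d(w1)$) satisfies $\limsup_n d(A\upharpoonright n)=\infty$; equivalently $\dim(A)=\liminf_n K(A\upharpoonright n)/n$. A Wadge reduction of $\mathcal A$ to $\mathcal B$ is a continuous $f:\mathbf C\to\mathbf C$ with $X\in\mathcal A\iff f(X)\in\mathcal B$; $\mathcal B$ is Wadge complete for $\boldsymbol\Gamma$ if $\mathcal B\in\boldsymbol\Gamma$ and every $\mathcal A\in\boldsymbol\Gamma$ Wadge reduces to $\mathcal B$. $\boldsymbol\Sigma^0_n,\boldsymbol\Pi^0_n$: Borel hierarchy; $\Sigma^0_n$: lightface arithmetical hierarchy. *)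

(* Defs.v *)
From Stdlib Require Cantor.
From mathcomp Require Import all_boot all_order all_algebra.
From mathcomp Require Import all_classical all_reals all_analysis.

Set Implicit Arguments.
Unset Strict Implicit.
Unset Printing Implicit Defensive.

Import Order.TTheory GRing.Theory Num.Theory.
Import numFieldNormedType.Exports.

Local Open Scope classical_set_scope.

(* Partial recursive functions on nat.  Tuples are coded by the Cantor        *)
(* bijection, which takes the place of arities and projections.               *)

Definition npair (a b : nat) : nat := Cantor.to_nat (a, b).

Inductive prec : Type :=
| Zero
| Succ
| Fst
| Snd
| Pair of prec & prec
| Comp of prec & prec
| Rec of prec & prec
| Mu of prec.

(* graph c x y: the partial function denoted by c converges on x with value y *)
(*   Comp f g  is  x |-> f (g x)                                              *)
(*   Rec f g   is  h<a, 0> = f a,  h<a, n+1> = g<a, <n, h<a, n>>>             *)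
(*   Mu f      is  x |-> the least y with f<x, y> = 0, provided that f<x, z>  *)
(*             converges for all z < y                                        *)
Fixpoint graph (c : prec) (x y : nat) : Prop :=
  match c with
  | Zero => y = 0
  | Succ => y = x.+1
  | Fst => y = (Cantor.of_nat x).1
  | Snd => y = (Cantor.of_nat x).2
  | Pair f g => exists a b, [/\ graph f x a, graph g x b & y = npair a b]
  | Comp f g => exists2 z, graph g x z & graph f z y
  | Rec f g =>
      let a := (Cantor.of_nat x).1 in
      let n := (Cantor.of_nat x).2 in
      exists h : nat -> nat,
        [/\ graph f a (h 0),
            forall i, i < n -> graph g (npair a (npair i (h i))) (h i.+1)
          & y = h n]
  | Mu f => graph f (npair x y) 0 /\
            forall z, z < y -> exists v, graph f (npair x z) v.+1
  end.

Definition ce (P : set nat) : Prop :=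
  exists c : prec, forall x, P x <-> exists y, graph c x y.

(* The number whose binary expansion is 1w. *)
Definition strcode (w : seq bool) : nat :=
  foldl (fun n (b : bool) => n.*2 + b) 1 w.

Definition prefix_of (X : cantor_space) (n : nat) : seq bool := mkseq X n.

Section ConstructiveDimension.
Variable R : realType.
Local Open Scope ring_scope.

Definition gale (s : R) (d : seq bool -> R) : Prop :=
  (forall w, 0 <= d w) /\
  forall w, 2 `^ s * d w = d (rcons w false) + d (rcons w true).

(* The rationals below d w are uniformly c.e. in w.  As d is nonnegative,     *)
(* only the nonnegative rationals a / (b + 1) matter.                         *)
Definition lower_semicomputable (d : seq bool -> R) : Prop :=
  exists2 P : set nat, ce P &
    forall w (a b : nat),
      P (npair (strcode w) (npair a b)) <-> a%:R / b.+1%:R < d w.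

Definition succeeds (d : seq bool -> R) (X : cantor_space) : Prop :=
  limn_esup (fun n => (d (prefix_of X n))%:E) = +oo%E.

Definition cdim (X : cantor_space) : R :=
  inf [set s : R | exists d : seq bool -> R,
    [/\ gale s d, lower_semicomputable d & succeeds d X]].

Definition DIM (alpha : R) : set cantor_space := [set X | cdim X = alpha].

End ConstructiveDimension.

(* The finite levels of the Borel hierarchy start at 1: level 0 is a dummy.   *)
Fixpoint boldSigma0 (T : topologicalType) (n : nat) : set (set T) :=
  match n with
  | 0 => set0
  | 1 => [set A | open A]
  | n'.+1 => [set A | exists2 B : (set T)^nat,
               forall i, boldSigma0 n' (~` B i) & A = \bigcup_i B i]
  end.

Definition boldPi0 (T : topologicalType) (n : nat) : set (set T) :=
  [set A | boldSigma0 n (~` A)].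

(* The arithmetical hierarchy for sequences of classes, uniformly in the      *)
(* index: a uniformly Sigma^0_1 sequence is given by a c.e. sequence of sets  *)
(* of strings generating the open sets, and Sigma^0_(n+1) classes are         *)
(* effective unions of complements of Sigma^0_n classes.  Level 0 is a dummy. *)
Fixpoint unif_lightSigma0 (n : nat) : set (nat -> set cantor_space) :=
  match n with
  | 0 => set0
  | 1 => [set A | exists2 W : set nat, ce W &
           forall p X, A p X <->
             exists k, W (npair p (strcode (prefix_of X k)))]
  | n'.+1 => [set A | exists2 B : nat -> set cantor_space,
               unif_lightSigma0 n' B &
               forall p, A p = \bigcup_i ~` B (npair p i)]
  end.

Definition lightSigma0 (n : nat) : set (set cantor_space) :=
  [set A | unif_lightSigma0 n (fun=> A)].

Definition wadge_reducible (A B : set cantor_space) : Prop :=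
  exists2 f : cantor_space -> cantor_space,
    continuous f & forall X, A X <-> B (f X).

Definition wadge_complete (Gamma : set (set cantor_space))
    (B : set cantor_space) : Prop :=
  Gamma B /\ forall A, Gamma A -> wadge_reducible A B.

(* Main.v *)
(* Upper bound.  Call a string of length n covered at rate p / q if, for some  *)
(* program e <= n, it is among the first (p / q) ^ n strings of length n       *)
(* enumerated by e.  If a lower semicomputable s-gale d with 2 ^ s < p / q     *)
(* succeeds on X then, as the strings with d > 1 are c.e. and few by Kraft's   *)
(* inequality, infinitely many prefixes of X are covered.  Conversely, the     *)
(* covered strings are c.e. and few, so they are charged by a lower            *)
(* semicomputable gale.  Hence dim X >= alpha and dim X <= alpha are           *)
(* respectively Pi^0_3 and Pi^0_2 conditions on X.                             *)
(*                                                                             *)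
(* Hardness.  A Pi^0_3 set A has the form {X : lim_t g(X|t) = oo}.  The        *)
(* sequence f(X) is divided into blocks [(t + 1)!, (t + 2)!); positions of the *)
(* t-th block below rate_t * (t + 2)! are free and the others are zero, where  *)
(* rate_t = alpha (1 - 1 / (g(X|t) + 2)).  The free bits are chosen greedily   *)
(* to halve one measure M that dominates the measures of all lower             *)
(* semicomputable gales; so dim f(X) is at least the lower density of the free *)
(* positions, while the long runs of zeros give dim f(X) <= liminf_t rate_t,   *)
(* which is alpha exactly when X is in A.                                      *)
(*                                                                             *)
(* A diagonal set separates Pi^0_3 from Sigma^0_3, which is closed under       *)
(* continuous preimages.                                                       *)

Require Import Defs.
From mathcomp Require Import all_boot all_order all_algebra.
From mathcomp Require Import all_classical all_reals all_analysis.
From mathcomp Require Import zify ring lra.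

Set Implicit Arguments.
Unset Strict Implicit.
Unset Printing Implicit Defensive.

Import Order.TTheory GRing.Theory Num.Theory.
Import numFieldNormedType.Exports.

(** * Computable functions and c.e. sets *)

Section Computable.
Local Open Scope nat_scope.

(** Everything rests on reading dimension as a growth rate of covers. [galeset_io_covered] turns a
    successful gale into infinitely many covered prefixes, by running the c.e. set of strings of
    capital above 1 on a universal machine ([ce_halts_at]). [galeset_cover] turns a sparse
    computable enumeration of covers back into a gale. Together they give [cdim_leP] and [cdim_geP],
    where dimension is tested against rational rates p / q and one fixed c.e. family for each rate;
    counting quantifiers then yields [DIM_Pi3].

    For hardness, [boldPi0_3_normal_form] expresses membership in a Pi^0_3 set as divergence to
    infinity of a function g of the prefixes. The reduction sends X to a sequence whose density of
    free bits in each block is a value below alpha that tends to alpha exactly when g does to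
    infinity. [cdim_greedy_ge] with [nfree_ge] bounds its dimension below, since free bits chosen
    against the measure of [dominating_measure] cost every gale a factor 2; [cdim_le_rate] bounds it
    above, since a block ends in a run of zeros. Non-membership in Sigma^0_3 follows by pulling back
    along a reduction of [cantor_diagonal]. *)

Definition nfst (x : nat) := (Cantor.of_nat x).1.
Definition nsnd (x : nat) := (Cantor.of_nat x).2.

Lemma nfstE a b : nfst (npair a b) = a.
Proof. by rewrite /nfst /npair Cantor.cancel_of_to. Qed.

Lemma nsndE a b : nsnd (npair a b) = b.
Proof. by rewrite /nsnd /npair Cantor.cancel_of_to. Qed.

Lemma npairK x : npair (nfst x) (nsnd x) = x.
Proof. by rewrite /npair /nfst /nsnd -surjective_pairing Cantor.cancel_to_of. Qed.

Definition computable (f : nat -> nat) :=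
  exists c, forall x y, graph c x y <-> y = f x.

Lemma computable_ext f g : f =1 g -> computable f -> computable g.
Proof. by move=> fg [c cP]; exists c => x y; rewrite cP fg. Qed.

Lemma computable_id : computable (fun x => x).
Proof.
exists (Pair Fst Snd) => x y /=; split => [[a [b [-> -> ->]]]|->].
  exact: npairK.
by exists (nfst x), (nsnd x); rewrite npairK.
Qed.

Lemma computable_comp f g :
  computable f -> computable g -> computable (fun x => f (g x)).
Proof.
move=> [c cP] [d dP]; exists (Comp c d) => x y /=; split=> [[z]|->].
  by move=> /dP -> /cP.
by exists (g x); [apply/dP|apply/cP].
Qed.

Lemma computable_succ f : computable f -> computable (fun x => (f x).+1).
Proof. by apply: (@computable_comp S); exists Succ. Qed.

Lemma computable_nfst f : computable f -> computable (fun x => nfst (f x)).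
Proof. by apply: (@computable_comp nfst); exists Fst. Qed.

Lemma computable_nsnd f : computable f -> computable (fun x => nsnd (f x)).
Proof. by apply: (@computable_comp nsnd); exists Snd. Qed.

Lemma computable_const n : computable (fun=> n).
Proof. by elim: n => [|n IH]; [exists Zero|apply: computable_succ]. Qed.

Lemma computable_pair f g : computable f -> computable g ->
  computable (fun x => npair (f x) (g x)).
Proof.
move=> [c cP] [d dP]; exists (Pair c d) => x y /=; split.
  by move=> [a [b [/cP -> /dP -> ->]]].
by move=> ->; exists (f x), (g x); split=> //; [apply/cP|apply/dP].
Qed.

Lemma computable_prec (h : nat -> nat -> nat) f g :
  computable f -> computable g ->
  (forall a, h a 0 = f a) ->
  (forall a n, h a n.+1 = g (npair a (npair n (h a n)))) ->
  forall u v, computable u -> computable v -> computable (fun x => h (u x) (v x)).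
Proof.
move=> [c cP] [d dP] h0 hS u v cu cv.
apply: (@computable_ext (fun x => (fun y => h (nfst y) (nsnd y)) (npair (u x) (v x)))).
  by move=> x; rewrite nfstE nsndE.
apply: (@computable_comp (fun y => h (nfst y) (nsnd y))); last exact: computable_pair.
exists (Rec c d) => x y; rewrite [graph _ _ _]/= -/(nfst x) -/(nsnd x); split=> [[k [k0 kS ->]]|->].
  have kh i : i <= nsnd x -> k i = h (nfst x) i.
    elim: i => [_|i IH ilt]; first by move/cP: k0 => ->; rewrite h0.
    by move: (kS _ ilt) => /dP ->; rewrite IH ?hS // ltnW.
  exact: kh.
exists (h (nfst x)); split => //; first by apply/cP; rewrite h0.
by move=> i _; apply/dP.
Qed.

Lemma computable_add f g : computable f -> computable g ->
  computable (fun x => f x + g x).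
Proof.
apply: (@computable_prec addn (fun x => x) (fun y => (nsnd (nsnd y)).+1)).
- exact: computable_id.
- by do ! [apply: computable_succ|apply: computable_nsnd]; exact: computable_id.
- by move=> a; rewrite addn0.
- by move=> a n; rewrite !nsndE addnS.
Qed.

Lemma computable_pred f : computable f -> computable (fun x => (f x).-1).
Proof.
move=> cf; apply: (@computable_prec (fun _ n => n.-1) (fun=> 0) (fun y => nfst (nsnd y))
  _ _ _ _ (fun=> 0)) => //.
- exact: computable_const.
- by apply: computable_nfst; apply: computable_nsnd; exact: computable_id.
- by move=> a n; rewrite nsndE nfstE.
- exact: computable_const.
Qed.

Lemma computable_sub f g : computable f -> computable g ->
  computable (fun x => f x - g x).
Proof.
apply: (@computable_prec subn (fun x => x) (fun y => (nsnd (nsnd y)).-1)).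
- exact: computable_id.
- apply: computable_pred; do 2 apply: computable_nsnd; exact: computable_id.
- by move=> a; rewrite subn0.
- by move=> a n; rewrite !nsndE subnS.
Qed.

(** Sums of truth values count; multiplication, quotients and logarithms are all obtained below as
    such bounded sums. *)
Lemma computable_sum (F : nat -> nat -> nat) b :
  computable (fun y => F (nfst y) (nsnd y)) -> computable b ->
  computable (fun x => \sum_(i < b x) F x i).
Proof.
move=> cF cb.
apply: (@computable_prec (fun a n => \sum_(i < n) F a i) (fun=> 0)
  (fun y => nsnd (nsnd y) + F (nfst y) (nfst (nsnd y))) _ _ _ _ (fun x => x) b) => //.
- exact: computable_const.
- apply: computable_add; first by do 2 apply: computable_nsnd; exact: computable_id.
  apply: (@computable_ext (fun y => (fun y => F (nfst y) (nsnd y)) (npair (nfst y) (nfst (nsnd y))))).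
    by move=> y; rewrite nfstE nsndE.
  apply: (computable_comp cF); apply: computable_pair; apply: computable_nfst;
    [|apply: computable_nsnd]; exact: computable_id.
- by move=> a; rewrite big_ord0.
- by move=> a n; rewrite big_ord_recr /= !nfstE !nsndE nfstE.
- exact: computable_id.
Qed.

Lemma computable_mul f g : computable f -> computable g ->
  computable (fun x => f x * g x).
Proof.
move=> cf cg; apply: (@computable_ext (fun x => \sum_(i < g x) f x)).
  by move=> x; rewrite sum_nat_const card_ord mulnC.
apply: (@computable_sum (fun x _ => f x)) => //.
by apply: (@computable_comp f) => //; apply: computable_nfst; exact: computable_id.
Qed.

Lemma computable_exp f g : computable f -> computable g ->
  computable (fun x => f x ^ g x).
Proof.
apply: (@computable_prec expn (fun=> 1) (fun y => nfst y * nsnd (nsnd y))).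
- exact: computable_const.
- apply: computable_mul; first by apply: computable_nfst; exact: computable_id.
  by do 2 apply: computable_nsnd; exact: computable_id.
- by move=> a; rewrite expn0.
- by move=> a n; rewrite !nsndE nfstE expnS.
Qed.

Lemma computable_leq f g : computable f -> computable g ->
  computable (fun x => f x <= g x).
Proof.
move=> cf cg; apply: (@computable_ext (fun x => 1 - (f x - g x))).
  by move=> x; rewrite -subn_eq0; case: (f x - g x).
by apply: computable_sub; [exact: computable_const|exact: computable_sub].
Qed.

Lemma computable_and (f g : nat -> bool) : computable f -> computable g ->
  computable (fun x => f x && g x).
Proof.
move=> cf cg; apply: (@computable_ext (fun x => f x * g x)).
  by move=> x; case: (f x); case: (g x).
exact: computable_mul.
Qed.

Lemma computable_neg (f : nat -> bool) : computable f ->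
  computable (fun x => ~~ f x).
Proof.
move=> cf; apply: (@computable_ext (fun x => 1 - f x)).
  by move=> x; case: (f x).
by apply: computable_sub => //; exact: computable_const.
Qed.

Lemma computable_eq f g : computable f -> computable g ->
  computable (fun x => f x == g x).
Proof.
move=> cf cg; apply: (@computable_ext (fun x => (f x <= g x) && (g x <= f x))).
  by move=> x; rewrite eqn_leq.
by apply: computable_and; exact: computable_leq.
Qed.

Lemma computable_if (b : nat -> bool) f g :
  computable b -> computable f -> computable g ->
  computable (fun x => if b x then f x else g x).
Proof.
move=> cb cf cg; apply: (@computable_ext (fun x => b x * f x + ~~ b x * g x)).
  by move=> x; case: (b x); rewrite ?mul1n ?mul0n ?addn0.
apply: computable_add; apply: computable_mul => //; exact: computable_neg.
Qed.

Lemma sum_ltn n k : k <= n -> \sum_(i < n) (i < k) = k.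
Proof.
move=> kn; rewrite -(big_mkord xpredT (fun i => (i < k : nat))) (@big_cat_nat _ _ _ k) //=.
rewrite [X in _ + X = _]big1_seq; last first.
  by move=> i; rewrite mem_index_iota => /andP[_ /andP[ki _]]; rewrite ltnNge ki.
rewrite addn0 (eq_big_nat _ _ (F2 := fun=> 1)) ?sum_nat_const_nat ?subn0 ?muln1 //.
by move=> i /andP[_ ->].
Qed.

Lemma computable_div f g : computable f -> computable g ->
  computable (fun x => f x %/ g x).
Proof.
move=> cf cg.
(* The quotient counts the positive multiples of g x up to f x; the guard gives the value 0 for
   division by 0. *)
apply: (@computable_ext (fun x => \sum_(i < f x) ((1 <= g x) && (i.+1 * g x <= f x)))).
  move=> x; case: (posnP (g x)) => [->|g0]; first by rewrite divn0 big1.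
  rewrite (eq_bigr (fun i : 'I_(f x) => (i < f x %/ g x : nat))).
    by rewrite sum_ltn ?leq_div.
  by move=> i _; rewrite leq_divRL.
apply: (@computable_sum (fun x i => (1 <= g x) && (i.+1 * g x <= f x) : nat)) => //.
have c1 : computable nfst by apply: computable_nfst; exact: computable_id.
have c2 : computable nsnd by apply: computable_nsnd; exact: computable_id.
apply: computable_and; apply: computable_leq.
- exact: computable_const.
- exact: (computable_comp cg).
- by apply: computable_mul; [apply: computable_succ|exact: (computable_comp cg)].
- exact: (computable_comp cf).
Qed.

Lemma computable_log f : computable f -> computable (fun x => trunc_log 2 (f x)).
Proof.
move=> cf; apply: computable_comp cf.
apply: (@computable_ext (fun x => \sum_(i < x) (2 ^ i.+1 <= x))).
  move=> x; rewrite (eq_bigr (fun i : 'I_x => (i < trunc_log 2 x : nat))).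
    rewrite sum_ltn //; case: (posnP x) => [->|x0]; first by rewrite trunc_log0.
    apply: leq_trans (trunc_logP (isT : 1 < 2) x0).
    exact: ltnW (ltn_expl _ _).
  move=> i _; congr nat_of_bool.
  have x0 : 0 < x by case: (x) i => [[]|].
  apply/idP/idP => [/trunc_log_max|h]; first exact.
  by apply: leq_trans (trunc_logP (isT : 1 < 2) x0); rewrite leq_exp2l.
have c1 : computable nfst by apply: computable_nfst; exact: computable_id.
have c2 : computable nsnd by apply: computable_nsnd; exact: computable_id.
apply: (@computable_sum (fun x i => (2 ^ i.+1 <= x) : nat)); last exact: computable_id.
apply: computable_leq => //; apply: computable_exp; first exact: computable_const.
exact: computable_succ.
Qed.

Lemma computable_iter step n s : computable step -> computable n -> computable s ->
  computable (fun x => iter (n x) step (s x)).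
Proof.
move=> cstep cn cs.
apply: (@computable_prec (fun a k => iter k step a) (fun x => x)
  (fun y => step (nsnd (nsnd y))) _ _ _ _ s n) => //.
- exact: computable_id.
- by apply: (computable_comp cstep); do 2 apply: computable_nsnd; exact: computable_id.
- by move=> a k; rewrite !nsndE.
Qed.

End Computable.

Ltac computability := repeat first
  [ assumption | exact: computable_const | exact: computable_id
  | apply: computable_pair | apply: computable_succ
  | apply: computable_nfst | apply: computable_nsnd
  | apply: computable_add | apply: computable_sub | apply: computable_mul
  | apply: computable_exp | apply: computable_div | apply: computable_log
  | apply: computable_and | apply: computable_neg | apply: computable_leq
  | apply: computable_eq | apply: computable_if | apply: computable_pred ].

Section CE.
Local Open Scope nat_scope.

Lemma ce_exists (r : nat -> nat -> bool) :
  computable (fun y => r (nfst y) (nsnd y)) -> ce [set x | exists n, r x n].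
Proof.
(* [Mu] searches for a zero, hence the negation. *)
move=> cr; have [c cP] : computable (fun y => ~~ r (nfst y) (nsnd y)) by exact: computable_neg.
exists (Mu c) => x; split=> [[n rn]|[y /= [+ _]]].
  have ex : exists n, r x n by exists n.
  exists (ex_minn ex); case: ex_minnP => m rm mmin /=; split.
    by apply/cP; rewrite nfstE nsndE rm.
  move=> z zm; exists 0; apply/cP; rewrite nfstE nsndE.
  by case: (boolP (r x z)) => // /mmin; rewrite leqNgt zm.
by move=> /cP; rewrite nfstE nsndE; case: (boolP (r x y)) => // ryx _; exists y.
Qed.

Lemma ce_preimage (P : set nat) f : ce P -> computable f -> ce [set x | P (f x)].
Proof.
move=> [c cP] [d dP]; exists (Comp c d) => x; split=> /=.
  by move=> /cP[y cy]; exists y, (f x) => //; apply/dP.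
by move=> [y [z /dP -> cy]]; apply/cP; exists y.
Qed.

End CE.

(** * A universal machine *)

Section Machine.
Local Open Scope nat_scope.

Lemma graph_recE f g x y : graph (Rec f g) x y <->
  exists h : nat -> nat, [/\ graph f (nfst x) (h 0),
    forall i, i < nsnd x -> graph g (npair (nfst x) (npair i (h i))) (h i.+1)
    & y = h (nsnd x)].
Proof. by []. Qed.

(* Conversion must not unfold the Cantor pairing of numerals. *)
Opaque npair nfst nsnd.

(* States of an abstract machine for [prec], coded by numbers: [ev c x K]     *)
(* evaluates the code c on x, [rt v K] returns v to the stack of frames K.    *)
Definition ev (c x K : nat) := npair 0 (npair c (npair x K)).
Definition rt (v K : nat) := npair 1 (npair 0 (npair v K)).
(* Frame tags k: 0 and 1 for the components of Pair, 2 Comp, 3 Rec, 4 Mu.      *)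
Definition push (k a b c K : nat) := (npair k (npair a (npair b (npair c K)))).+1.

Fixpoint enc (c : prec) : nat :=
  match c with
  | Zero => npair 0 0
  | Succ => npair 1 0
  | Fst => npair 2 0
  | Snd => npair 3 0
  | Pair f g => npair 4 (npair (enc f) (enc g))
  | Comp f g => npair 5 (npair (enc f) (enc g))
  | Rec f g => npair 6 (npair (enc f) (enc g))
  | Mu f => npair 7 (npair (enc f) 0)
  end.

Definition ev_step (s : nat) : nat :=
  let c := nfst (nsnd s) in let x := nfst (nsnd (nsnd s)) in let K := nsnd (nsnd (nsnd s)) in
  let f := nfst (nsnd c) in let g := nsnd (nsnd c) in
  if nfst c == 0 then rt 0 K else
  if nfst c == 1 then rt x.+1 K else
  if nfst c == 2 then rt (nfst x) K else
  if nfst c == 3 then rt (nsnd x) K else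
  if nfst c == 4 then ev f x (push 0 g x 0 K) else
  if nfst c == 5 then ev g x (push 2 f 0 0 K) else
  if nfst c == 6 then ev f (nfst x) (push 3 g x 0 K) else
  ev f (npair x 0) (push 4 f x 0 K).

Definition rt_step (s : nat) : nat :=
  let v := nfst (nsnd (nsnd s)) in let F := (nsnd (nsnd (nsnd s))).-1 in
  let a := nfst (nsnd F) in let b := nfst (nsnd (nsnd F)) in
  let c := nfst (nsnd (nsnd (nsnd F))) in let K := nsnd (nsnd (nsnd (nsnd F))) in
  if nfst F == 0 then ev a b (push 1 v 0 0 K) else
  if nfst F == 1 then rt (npair a v) K else
  if nfst F == 2 then ev a v K else
  if nfst F == 3 then
    (if c == nsnd b then rt v K
     else ev a (npair (nfst b) (npair c v)) (push 3 a b c.+1 K)) else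
  if v == 0 then rt c K else ev a (npair b c.+1) (push 4 a b c.+1 K).

(** [push] is a successor, so the stack 0 is the empty one. *)
Definition final (s : nat) : bool := (nfst s == 1) && (nsnd (nsnd (nsnd s)) == 0).

(** Final states are fixed points, which makes halting within n steps monotone in n. *)
Definition step (s : nat) : nat :=
  if nfst s == 0 then ev_step s else if nsnd (nsnd (nsnd s)) == 0 then s else rt_step s.

Lemma computable_step : computable step.
Proof. by rewrite /step /ev_step /rt_step /ev /rt /push; computability. Qed.

Lemma stepE c x K : step (ev c x K) = ev_step (ev c x K).
Proof. by rewrite /step nfstE. Qed.

Lemma step_rtE v k a b c K :
  step (rt v (push k a b c K)) = rt_step (rt v (push k a b c K)).
Proof. by rewrite /step /rt /push !nfstE !nsndE. Qed.

Definition npairE := (nfstE, nsndE).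

Lemma step_pair f g x K :
  step (ev (enc (Pair f g)) x K) = ev (enc f) x (push 0 (enc g) x 0 K).
Proof. by rewrite stepE /ev_step /ev /= !npairE. Qed.

Lemma step_comp f g x K :
  step (ev (enc (Comp f g)) x K) = ev (enc g) x (push 2 (enc f) 0 0 K).
Proof. by rewrite stepE /ev_step /ev /= !npairE. Qed.

Lemma step_rec f g x K :
  step (ev (enc (Rec f g)) x K) = ev (enc f) (nfst x) (push 3 (enc g) x 0 K).
Proof. by rewrite stepE /ev_step /ev /= !npairE. Qed.

Lemma step_mu f x K :
  step (ev (enc (Mu f)) x K) = ev (enc f) (npair x 0) (push 4 (enc f) x 0 K).
Proof. by rewrite stepE /ev_step /ev /= !npairE. Qed.

Lemma step_rt0 v a b c K :
  step (rt v (push 0 a b c K)) = ev a b (push 1 v 0 0 K).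
Proof. by rewrite step_rtE /rt_step /rt /push /= !npairE. Qed.

Lemma step_rt1 v a b c K : step (rt v (push 1 a b c K)) = rt (npair a v) K.
Proof. by rewrite step_rtE /rt_step /rt /push /= !npairE. Qed.

Lemma step_rt2 v a b c K : step (rt v (push 2 a b c K)) = ev a v K.
Proof. by rewrite step_rtE /rt_step /rt /push /= !npairE. Qed.

Lemma step_rt3 v a b c K :
  step (rt v (push 3 a b c K)) = if c == nsnd b then rt v K
    else ev a (npair (nfst b) (npair c v)) (push 3 a b c.+1 K).
Proof. by rewrite step_rtE /rt_step /rt /push /= !npairE. Qed.

Lemma step_rt4 v a b c K :
  step (rt v (push 4 a b c K)) =
    if v == 0 then rt c K else ev a (npair b c.+1) (push 4 a b c.+1 K).
Proof. by rewrite step_rtE /rt_step /rt /push /= !npairE. Qed.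

Lemma ev_nonfinal c x K : final (ev c x K) = false.
Proof. by rewrite /final nfstE. Qed.

Lemma rt_nonfinal v k a b c K : final (rt v (push k a b c K)) = false.
Proof. by rewrite /final !npairE. Qed.

Definition halts_in n s := final (iter n step s).

Lemma halts_inS n s : halts_in n.+1 s = halts_in n (step s).
Proof. by rewrite /halts_in iterSr. Qed.

Lemma final_step s : final s -> step s = s.
Proof. by move=> /andP[/eqP e1 /eqP e2]; rewrite /step e1 e2 eqxx. Qed.

Lemma halts_in_ev n c x K : halts_in n (ev c x K) ->
  exists2 n', n = n'.+1 & halts_in n' (step (ev c x K)).
Proof.
by case: n => [|n]; [rewrite /halts_in /= ev_nonfinal|rewrite halts_inS; exists n].
Qed.

Lemma halts_in_rt n v k a b c K : halts_in n (rt v (push k a b c K)) ->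
  exists2 n', n = n'.+1 & halts_in n' (step (rt v (push k a b c K))).
Proof.
by case: n => [|n]; [rewrite /halts_in /= rt_nonfinal|rewrite halts_inS; exists n].
Qed.

(** A halting run has to return a value to K before K can be consumed. The bound m < n on the time
    left supports the induction for [Mu]. *)
Lemma halts_sound c n x K : halts_in n (ev (enc c) x K) ->
  exists y m, [/\ m < n, graph c x y & halts_in m (rt y K)].
Proof.
elim: c n x K => [||||f IHf g IHg|f IHf g IHg|f IHf g IHg|f IHf] n x K
  /halts_in_ev[n' -> ].
- by rewrite stepE /ev_step /ev /= !npairE => h; exists 0, n'.
- by rewrite stepE /ev_step /ev /= !npairE => h; exists x.+1, n'.
- by rewrite stepE /ev_step /ev /= !npairE => h; exists (nfst x), n'.
- by rewrite stepE /ev_step /ev /= !npairE => h; exists (nsnd x), n'.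
- rewrite step_pair => /IHf[a [m [mn ga /halts_in_rt[m' em]]]].
  rewrite step_rt0 => /IHg[b [k [km gb /halts_in_rt[k' ek]]]].
  rewrite step_rt1 => h; exists (npair a b), k'; split=> //; last by exists a, b.
  by subst; lia.
- rewrite step_comp => /IHg[z [m [mn gz /halts_in_rt[m' em]]]].
  rewrite step_rt2 => /IHf[y [k [km gy h]]].
  by exists y, k; split=> //; [subst; lia|exists z].
- rewrite step_rec => /IHf[y0 [m [mn g0 h]]].
  (* Loop invariant: h records the values computed in the first i rounds, and j rounds remain. *)
  have loop j : forall i m (h : nat -> nat), nsnd x = i + j -> m < n'.+1 ->
      graph f (nfst x) (h 0) ->
      (forall k, k < i -> graph g (npair (nfst x) (npair k (h k))) (h k.+1)) ->
      halts_in m (rt (h i) (push 3 (enc g) x i K)) ->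
      exists y m', [/\ m' < n'.+1, graph (Rec f g) x y & halts_in m' (rt y K)].
    elim: j => [|j IHj] i k hh ei kn h0 hS /halts_in_rt[k' ek];
      rewrite step_rt3 ei.
      rewrite addn0 eqxx => hk; exists (hh i), k'; split=> //; first by lia.
      by apply/graph_recE; exists hh; rewrite ei addn0.
    rewrite -[X in X == _]addn0 eqn_add2l /= => /IHg[y [l [lk gy hl]]].
    apply: (IHj i.+1 l (fun u => if u == i.+1 then y else hh u)).
    - by rewrite ei addnS addSn.
    - by lia.
    - by [].
    - move=> u; rewrite ltnS leq_eqVlt => /orP[/eqP ->|ui].
        by rewrite eqxx ltn_eqF.
      by rewrite !ltn_eqF ?ltnS // 1?ltnW //; exact: hS.
    - by rewrite eqxx.
  apply: (loop (nsnd x) 0 m (fun=> y0)) => //; lia.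
- rewrite step_mu => h.
  (* The search has no a priori bound, so the induction is on the remaining running time k. *)
  have loop k : forall i, k <= n' ->
      (forall z, z < i -> exists v, graph f (npair x z) v.+1) ->
      halts_in k (ev (enc f) (npair x i) (push 4 (enc f) x i K)) ->
      exists y m', [/\ m' < n'.+1, graph (Mu f) x y & halts_in m' (rt y K)].
    elim/ltn_ind: k => k IHk i kn hi /IHf[v [l [lk gv /halts_in_rt[l' el]]]].
    rewrite step_rt4; case: eqP => [v0|/eqP v0] hl.
      exists i, l'; split=> //; first by lia.
      by rewrite v0 in gv.
    apply: (IHk l' _ i.+1) => //; [lia|lia|move=> z].
    rewrite ltnS leq_eqVlt => /orP[/eqP ->|]; last exact: hi.
    by exists v.-1; rewrite prednK ?lt0n.
  by apply: (loop n' 0).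
Qed.

Definition halts s := exists n, halts_in n s.

Lemma halts_step s : halts (step s) -> halts s.
Proof. by move=> [n h]; exists n.+1; rewrite halts_inS. Qed.

(** Stated for an arbitrary continuation K, so that each subcomputation can be chained to the frame
    awaiting its value. *)
Lemma halts_complete c x y K : graph c x y -> halts (rt y K) ->
  halts (ev (enc c) x K).
Proof.
elim: c x y K => [||||f IHf g IHg|f IHf g IHg|f IHf g IHg|f IHf] x y K.
- by move=> /= -> h; apply: halts_step; rewrite stepE /ev_step /ev /= !npairE.
- by move=> /= -> h; apply: halts_step; rewrite stepE /ev_step /ev /= !npairE.
- by move=> /= -> h; apply: halts_step; rewrite stepE /ev_step /ev /= !npairE.
- by move=> /= -> h; apply: halts_step; rewrite stepE /ev_step /ev /= !npairE.
- move=> [a [b [ga gb ->]]] h; apply: halts_step; rewrite step_pair.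
  apply: (IHf _ _ _ ga); apply: halts_step; rewrite step_rt0.
  by apply: (IHg _ _ _ gb); apply: halts_step; rewrite step_rt1.
- move=> [z gz gy] h; apply: halts_step; rewrite step_comp.
  apply: (IHg _ _ _ gz); apply: halts_step; rewrite step_rt2.
  exact: (IHf _ _ _ gy).
- move=> /graph_recE[hh [h0 hS ->]] h.
  apply: halts_step; rewrite step_rec; apply: (IHf _ _ _ h0).
  suff: forall j i, i + j = nsnd x -> halts (rt (hh i) (push 3 (enc g) x i K)).
    by apply.
  elim=> [|j IHj] i eij; apply: halts_step; rewrite step_rt3 -eij.
    by rewrite addn0 eqxx; rewrite -eij addn0 in h.
  rewrite -[X in X == _]addn0 eqn_add2l /=.
  apply: (IHg _ (hh i.+1)); first by apply: hS; rewrite -eij; lia.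
  by apply: IHj; rewrite -eij addSnnS.
- move=> [gy gz] h; apply: halts_step; rewrite step_mu.
  suff: forall j i, i + j = y -> halts (ev (enc f) (npair x i) (push 4 (enc f) x i K)).
    by apply.
  elim=> [|j IHj] i eij.
    apply: (IHf _ 0); first by rewrite -(addn0 i) eij.
    by apply: halts_step; rewrite step_rt4 /= -(addn0 i) eij.
  have [v gv] : exists v, graph f (npair x i) v.+1 by apply: gz; rewrite -eij; lia.
  apply: (IHf _ v.+1) => //; apply: halts_step; rewrite step_rt4 /=.
  by apply: IHj; rewrite -eij addSnnS.
Qed.

(* The first halting time is m.+1, so that at most one m qualifies: this      *)
(* enumerates every c.e. set without repetitions.                             *)
Definition halts_at (e x m : nat) : bool :=
  halts_in m.+1 (ev e x 0) && ~~ halts_in m (ev e x 0).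

Lemma computable_halts_at e x m :
  computable e -> computable x -> computable m ->
  computable (fun y => halts_at (e y) (x y) (m y)).
Proof.
move=> ce cx cm.
have ch k : computable k -> computable (fun y => halts_in (k y) (ev (e y) (x y) 0)).
  move=> ck; apply: (@computable_comp (fun s => final s : nat)
    (fun y => iter (k y) step (ev (e y) (x y) 0))).
    by rewrite /final; computability.
  by apply: computable_iter => //; [exact: computable_step|rewrite /ev; computability].
apply: computable_and; first by apply: ch; exact: computable_succ.
by apply: computable_neg; exact: ch.
Qed.

Lemma halts_in_leq n m s : n <= m -> halts_in n s -> halts_in m s.
Proof.
move=> /subnKC <- h; elim: (m - n) => [|k IH]; first by rewrite addn0.
by rewrite addnS /halts_in iterS final_step.
Qed.

Lemma halts_at_uniq e x m m' : halts_at e x m -> halts_at e x m' -> m = m'.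
Proof.
suff H u v : halts_at e x u -> halts_at e x v -> ~ u < v.
  by move=> h h'; apply/eqP; case: ltngtP => // /H H'; exfalso; exact: H'.
move=> /andP[hu _] /andP[_ /negP hv] uv; apply: hv; exact: halts_in_leq hu.
Qed.

Lemma ce_halts_at (P : set nat) : ce P ->
  exists e, forall x, P x <-> exists m, halts_at e x m.
Proof.
move=> [c cP]; exists (enc c) => x; rewrite cP; split=> [[y gy]|[m /andP[h _]]].
  have ex : exists n, halts_in n (ev (enc c) x 0).
    apply: (halts_complete gy); exists 0.
    by rewrite /halts_in /= /final /rt !npairE.
  case: (ex_minnP ex) => [[|m]] hm mmin; first by rewrite /halts_in /= ev_nonfinal in hm.
  exists m; rewrite /halts_at hm /=; apply/negP => /mmin.
  by rewrite ltnn.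
by have [y [? [_ ? _]]] := halts_sound h; exists y.
Qed.

End Machine.

(** * Gales from covers *)

Section Strcode.
Local Open Scope nat_scope.

Lemma strcode_rcons w b : strcode (rcons w b) = (strcode w).*2 + b.
Proof. by rewrite /strcode -cats1 foldl_cat. Qed.

Lemma strcode_bounds w : 2 ^ size w <= strcode w < 2 ^ (size w).+1.
Proof.
elim/last_ind: w => [//|w b /andP[h1 h2]]; rewrite strcode_rcons size_rcons !expnS.
by case: b; rewrite -mul2n; move: h1 h2; rewrite expnS; lia.
Qed.

Lemma strcode_gt0 w : 0 < strcode w.
Proof. by have /andP[+ _] := strcode_bounds w; apply: leq_trans; rewrite expn_gt0. Qed.

Lemma log_strcode w : trunc_log 2 (strcode w) = size w.
Proof. by apply: trunc_log_eq => //; exact: strcode_bounds. Qed.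

Lemma strcode_inj : injective strcode.
Proof.
elim/last_ind => [|w b IH] w'.
  by move=> e; apply/esym/nilP; rewrite /nilp -log_strcode -e log_strcode.
case/lastP: w' => [|w' b'] e.
  by apply/nilP; rewrite /nilp -log_strcode e log_strcode.
move: e; rewrite !strcode_rcons => e.
have [-> /IH ->] // : b = b' /\ strcode w = strcode w'.
by move: (strcode w) (strcode w') e => u v; case: b; case: b'; lia.
Qed.

Lemma prefix_ofS X n : prefix_of X n.+1 = rcons (prefix_of X n) (X n).
Proof. by rewrite /prefix_of -mkseqS. Qed.

Lemma size_prefix_of X n : size (prefix_of X n) = n.
Proof. by rewrite size_mkseq. Qed.

End Strcode.

Section Gales.
Variable R : realType.
Local Open Scope ring_scope.
Implicit Types (s : R) (d m : seq bool -> R).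

(** The values on cylinders of a finite measure on Cantor space; s-gales are these rescaled by 2^(s
    |w|). *)
Definition bitmeasure m :=
  (forall w, 0 <= m w) /\ forall w, m w = m (rcons w false) + m (rcons w true).

Lemma bitmeasure_gale s m : bitmeasure m ->
  gale s (fun w => (2 `^ s) ^+ size w * m w).
Proof.
move=> [m0 mD]; split=> w; first by rewrite mulr_ge0 ?exprn_ge0 ?powR_ge0.
by rewrite !size_rcons exprS -mulrDr -mD mulrA.
Qed.

Lemma gale_bitmeasure s d : gale s d ->
  bitmeasure (fun w => d w / (2 `^ s) ^+ size w).
Proof.
move=> [d0 dD]; have p0 : 0 < (2 : R) `^ s by rewrite powR_gt0.
split=> w; first by rewrite divr_ge0 ?exprn_ge0 ?powR_ge0.
rewrite !size_rcons -mulrDl -dD exprS; field.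
by rewrite expf_neq0 gt_eqF.
Qed.

Lemma bitmeasure_le_root m w : bitmeasure m -> m w <= m [::].
Proof.
move=> [m0 mD]; elim/last_ind: w => [//|w b]; apply: le_trans.
by rewrite [leRHS]mD; case: b; rewrite ?lerDl ?lerDr.
Qed.

(** The limit is described by its strict lower bounds, the form in which lower semicomputability is
    defined. *)
Lemma bitmeasure_series (mu : nat -> seq bool -> R) (B : R) :
  (forall i, bitmeasure (mu i)) -> (forall N, \sum_(i < N) mu i [::] <= B) ->
  exists2 m, bitmeasure m &
    forall w x, x < m w <-> exists N, x < \sum_(i < N) mu i w.
Proof.
move=> mumeas muB; pose S w N := \sum_(i < N) mu i w.
have Snd w : nondecreasing_seq (S w).
  apply/nondecreasing_seqP => n; rewrite /S big_ord_recr /= lerDl.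
  by have [] := mumeas n.
have Scv w : cvgn (S w).
  apply: nondecreasing_is_cvgn => //; exists B => _ [n _ <-].
  apply: le_trans (muB n); apply: ler_sum => i _; exact: bitmeasure_le_root.
exists (fun w => limn (S w)).
  split=> w.
    apply: limr_ge => //; apply: nearW => n; apply: sumr_ge0 => i _.
    by have [] := mumeas i.
  rewrite -limD //; congr (limn _); apply/funext => N.
  rewrite /S fctE /= -big_split /=; apply: eq_bigr => i _.
  by have [_] := mumeas i.
move=> w x; split=> [xl|[N]]; last first.
  by move=> /lt_le_trans; apply; exact: (nondecreasing_cvgn_le (Snd w)).
apply: contrapT => /forallNP h; move: xl; rewrite ltNge => /negP; apply.
apply: limr_le => //; apply: nearW => n; rewrite leNgt; apply/negP; exact: h.
Qed.

Lemma unbounded_tail (u : nat -> R) : (forall B, exists n, B < u n) ->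
  forall B N, exists2 n, (N <= n)%N & B < u n.
Proof.
move=> h B N; pose M := \big[Num.max/B]_(i < N) u i; have [n Mn] := h M.
exists n; last first.
  apply: le_lt_trans Mn; rewrite /M; elim/big_rec: _ => // i x _.
  by rewrite le_max => ->; rewrite orbT.
rewrite leqNgt; apply/negP => nN; move: Mn; rewrite ltNge => /negP; apply.
by rewrite /M (bigD1 (Ordinal nN)) //= le_max lexx.
Qed.

(** All values are finite, so an unbounded sequence stays unbounded on every tail. *)
Lemma succeedsP d X : succeeds d X <-> forall B, exists n, B < d (prefix_of X n).
Proof.
rewrite /succeeds /limn_esup /limf_esup; split=> [h B|h].
  apply: contrapT => /forallNP hB.
  suff : (+oo <= B%:E :> \bar R)%E by [].
  rewrite -h.
  apply: (@le_trans _ _ (ereal_sup [set (d (prefix_of X n))%:E | n in setT])).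
    by apply: ereal_inf_lbound; exists setT => //; exact: filterT.
  apply: ge_ereal_sup => _ [n _ <-]; rewrite lee_fin leNgt; apply/negP; exact: hB.
apply/eqP; rewrite eq_le leey /=; apply: le_ereal_inf_tmp => _ [V [N _ NV] <-].
rewrite leye_eq; apply/eqP; apply: eq_infty => B.
have [n Nn Bn] := unbounded_tail h B N.
apply: (@le_trans _ _ (d (prefix_of X n))%:E); first by rewrite lee_fin ltW.
by apply: ereal_sup_ubound; exists n => //; exact: NV.
Qed.

Lemma bernoulli (x : R) n : 1 <= x -> 1 + (x - 1) * n%:R <= x ^+ n.
Proof.
move=> x1; elim: n => [|n IH]; first by rewrite mulr0 addr0 expr0.
rewrite exprS -natr1.
apply: le_trans (_ : x * (1 + (x - 1) * n%:R) <= _); last by rewrite ler_wpM2l //; lra.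
have : 0 <= (x - 1) * (x - 1) * n%:R by rewrite !mulr_ge0 ?ler0n //; lra.
lra.
Qed.

Lemma expr_unbounded (x B : R) : 1 < x -> exists n0, forall n, (n0 <= n)%N -> B < x ^+ n.
Proof.
move=> x1; have xp : 0 < x - 1 by lra.
exists (Num.bound (`|B| / (x - 1))) => n nn.
apply: lt_le_trans (bernoulli n (ltW x1)); apply: le_lt_trans (ler_norm B) _.
have : `|B| / (x - 1) < n%:R.
  apply: lt_le_trans (archi_boundP _) _; first by rewrite divr_ge0 // ltW.
  by rewrite ler_nat.
by rewrite ltr_pdivrMr // mulrC; lra.
Qed.

Lemma posrat_between (a b : R) : 0 <= a < b ->
  exists x y : nat, [/\ (0 < x)%N, (0 < y)%N & a < x%:R / y%:R < b].
Proof.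
move=> /andP[a0 ab]; have [q] := rat_in_itvoo ab; rewrite in_itv /= => /andP[aq qb].
have q0 : 0 < q by rewrite -(ltr0q R) (le_lt_trans a0).
exists `|numq q|%N, `|denq q|%N; rewrite !absz_gt0 numq_eq0 gt_eqF // denq_neq0.
split=> //; suff -> : `|numq q|%N%:R / `|denq q|%N%:R = ratr q :> R by rewrite aq.
rewrite /ratr !natr_absz !ger0_norm ?denq_ge0 ?numq_ge0 //; exact: ltW.
Qed.

End Gales.

Section Nat.
Local Open Scope nat_scope.

(* If z = strcode v with l = size v then z * 2 ^ n %/ 2 ^ l is the code of    *)
(* the prefix of length n of the sequence v000...                             *)
Lemma dirac_split c z l n :
  (c == z * 2 ^ n %/ 2 ^ l) =
    (c.*2 + false == z * 2 ^ n.+1 %/ 2 ^ l)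
      + (c.*2 + true == z * 2 ^ n.+1 %/ 2 ^ l) :> nat.
Proof.
have <- : z * 2 ^ n.+1 %/ 2 ^ l %/ 2 = z * 2 ^ n %/ 2 ^ l.
  by rewrite -divnMA expnSr mulnA divnMr.
move: (z * 2 ^ n.+1 %/ 2 ^ l) => y; lia.
Qed.

End Nat.

Section Cover.
Variable R : realType.
Local Open Scope ring_scope.

Local Open Scope classical_set_scope.

Definition galeset (X : cantor_space) : set R :=
  [set s | exists d, [/\ gale s d, lower_semicomputable d & succeeds d X]].

Lemma exists_log2 (b : R) : 0 < b -> exists t, 2 `^ t = b.
Proof.
move=> b0; exists (ln b / ln 2); rewrite /powR gt_eqF //.
by rewrite divfK ?lnK // gt_eqF // ln_gt0 // ltr1n.
Qed.

Lemma geometric_le (r : R) n : 0 <= r < 1 -> \sum_(i < n) r ^+ i <= (1 - r)^-1.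
Proof.
move=> /andP[r0 r1]; rewrite -[leRHS]mul1r ler_pdivlMr ?subr_gt0 //.
suff -> : (\sum_(i < n) r ^+ i) * (1 - r) = 1 - r ^+ n.
  by rewrite gerBl exprn_ge0.
elim: n => [|n IH]; first by rewrite big_ord0 mul0r expr0 subrr.
by rewrite big_ord_recr /= mulrDl IH exprS; ring.
Qed.

Section Dirac.
Variables (D : nat -> bool) (z : nat -> nat).

(** The string with code c is a prefix of v000..., where v has code z t; [trunc_log 2] of a code is
    the length of the string. *)
Definition hit t c :=
  D t && (c == (z t * 2 ^ trunc_log 2 c %/ 2 ^ trunc_log 2 (z t)))%N.

Definition dirac_weight (g : R) t w := (hit t (strcode w))%:R * g ^+ trunc_log 2 (z t).

Lemma bitmeasure_dirac g t : 0 <= g -> bitmeasure (dirac_weight g t).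
Proof.
move=> g0; split=> w; first by rewrite mulr_ge0 ?exprn_ge0.
rewrite /dirac_weight -mulrDl; congr (_ * _); rewrite -natrD; congr _%:R.
rewrite /hit !strcode_rcons !log_strcode -!strcode_rcons !log_strcode !size_rcons.
by case: (D t) => //=; rewrite !strcode_rcons; exact: dirac_split.
Qed.

(** Grouped by length n, the masses are dominated by the geometric series of C (g k)^n. *)
Lemma sum_dirac_root (C k g : R) N : 0 <= C -> 0 <= k -> 0 <= g -> g * k < 1 ->
  (forall n N, (\sum_(t < N) (D t && (trunc_log 2 (z t) == n)))%N%:R <= C * k ^+ n) ->
  \sum_(t < N) dirac_weight g t [::] <= C / (1 - g * k).
Proof.
move=> C0 k0 g0 gk Dk; pose L := (\sum_(t < N) trunc_log 2 (z t)).+1.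
have lL (t : 'I_N) : (trunc_log 2 (z t) < L)%N.
  by rewrite ltnS (bigD1 t) //= leq_addr.
apply: (@le_trans _ _ (\sum_(t < N) \sum_(n < L)
    (D t && (trunc_log 2 (z t) == n))%:R * g ^+ n)).
  apply: ler_sum => t _; rewrite (bigD1 (Ordinal (lL t))) //= eqxx andbT.
  apply: le_trans (_ : (D t)%:R * g ^+ trunc_log 2 (z t) <= _).
    rewrite /dirac_weight ler_wpM2r ?exprn_ge0 // ler_nat /hit.
    by case: (D t) => //=; case: (_ == _).
  by rewrite lerDl sumr_ge0 // => i _; rewrite mulr_ge0 ?exprn_ge0.
rewrite exchange_big /=.
apply: (@le_trans _ _ (\sum_(n < L) C * (g * k) ^+ n)).
  apply: ler_sum => n _; rewrite -mulr_suml -natr_sum exprMn.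
  have -> : C * (g ^+ n * k ^+ n) = (C * k ^+ n) * g ^+ n by ring.
  by rewrite ler_wpM2r ?exprn_ge0 //; exact: Dk.
rewrite -mulr_sumr ler_wpM2l //; apply: geometric_le.
by rewrite mulr_ge0.
Qed.

(** Since x / y and g / h are rational, h ^ L N is a common denominator of the N-th partial sum, and
    comparing it with a / (b + 1) is a decidable inequality of naturals. *)
Lemma lower_semicomputable_dirac (x y g h : nat) (m : seq bool -> R) :
  computable D -> computable z -> (0 < x)%N -> (0 < y)%N -> (0 < h)%N ->
  (forall w r, r < m w <-> exists N, r < \sum_(t < N) dirac_weight (g%:R / h%:R) t w) ->
  lower_semicomputable (fun w => (x%:R / y%:R) ^+ size w * m w).
Proof.
move=> cD cz x0 y0 h0 mE.
pose L N := (\sum_(t < N) trunc_log 2 (z t))%N.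
pose A N c := (\sum_(t < N)
  hit t c * (g ^ trunc_log 2 (z t) * h ^ (L N - trunc_log 2 (z t))))%N.
pose r u N := (nfst (nsnd u) * (y ^ trunc_log 2 (nfst u) * h ^ L N) <
  (nsnd (nsnd u)).+1 * (x ^ trunc_log 2 (nfst u) * A N (nfst u)))%N.
exists [set u | exists N, r u N]%classic.
  apply: (@ce_exists r); rewrite /r.
  have cL f : computable f -> computable (fun u => L (f u)).
    move=> cf; apply: (@computable_sum (fun _ t => trunc_log 2 (z t))) => //.
    by computability; apply: (computable_comp cz); computability.
  have cA f k : computable f -> computable k -> computable (fun u => A (f u) (k u)).
    move=> cf ck; rewrite /A.
    pose F u t := (hit t (k u) * (g ^ trunc_log 2 (z t) * h ^ (L (f u) - trunc_log 2 (z t))))%N.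
    apply: (@computable_sum F) => //; rewrite /F /hit.
    have c1 : computable (fun u => k (nfst u)) by apply: (computable_comp ck); computability.
    have c2 : computable (fun u => f (nfst u)) by apply: (computable_comp cf); computability.
    have c3 : computable (fun u => z (nsnd u)) by apply: (computable_comp cz); computability.
    have c4 : computable (fun u => D (nsnd u)) by apply: (computable_comp cD); computability.
    have c5 : computable (fun u => L (f (nfst u))) by exact: cL.
    by computability.
  have c1 : computable (fun u => L (nsnd u)) by apply: cL; computability.
  have c2 : computable (fun u => A (nsnd u) (nfst (nfst u))) by apply: cA; computability.
  by computability.
move=> w a b /=; rewrite /r !nfstE !nsndE !nfstE !log_strcode.
have xy0 : 0 < (x%:R / y%:R : R) ^+ size w.
  by rewrite exprn_gt0 // divr_gt0 ?ltr0n.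
rewrite [X in _ < X]mulrC -ltr_pdivrMr //; apply: iff_sym; apply: (iff_trans (mE _ _)).
have sumE N : \sum_(t < N) dirac_weight (g%:R / h%:R) t w =
    (A N (strcode w))%:R / (h ^ L N)%:R :> R.
  rewrite natr_sum mulr_suml; apply: eq_bigr => t _; rewrite /dirac_weight.
  rewrite !natrM -mulrA; congr (_ * _); rewrite expr_div_n !natrX.
  have lL : (trunc_log 2 (z t) <= L N)%N by rewrite /L (bigD1 t) //= leq_addr.
  have hn0 k : (h%:R : R) ^+ k != 0 by rewrite expf_neq0 // pnatr_eq0 -lt0n.
  rewrite -[in X in _ = _ / X](subnK lL) exprD; field.
  by rewrite !hn0.
suff E N : (a%:R / b.+1%:R / (x%:R / y%:R) ^+ size w < \sum_(t < N) dirac_weight (g%:R / h%:R) t w)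
    = (a * (y ^ size w * h ^ L N) < b.+1 * (x ^ size w * A N (strcode w)))%N.
  by split=> [[N]|[N]]; [rewrite E|rewrite -E]; exists N.
rewrite sumE ltr_pdivrMr // ltr_pdivrMr ?ltr0n // expr_div_n.
have hyn0 : (h ^ L N)%:R * y%:R ^+ size w != 0 :> R.
  by rewrite natrX mulf_neq0 ?expf_neq0 // pnatr_eq0 -lt0n.
set AN := (A N _)%:R; set hL := (h ^ L N)%:R in hyn0 *.
have -> : AN / hL * (x%:R ^+ size w / y%:R ^+ size w) * b.+1%:R =
    b.+1%:R * (x%:R ^+ size w * AN) / (hL * y%:R ^+ size w).
  by field; move: hyn0; rewrite mulf_eq0 negb_or andbC.
rewrite ltr_pdivlMr; last first.
  by rewrite lt0r hyn0 /hL mulr_ge0 ?exprn_ge0.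
by rewrite /AN /hL -!natrX -!natrM ltr_nat [(h ^ _ * _)%N]mulnC.
Qed.

(* The gale charges, for each t with D t, the sequence v000... where v is the *)
(* string with code z t.                                                      *)
Lemma galeset_cover (X : cantor_space) (C s s' : R) :
  computable D -> computable z -> 0 <= C -> 0 <= s ->
  (forall n N, (\sum_(t < N) (D t && (trunc_log 2 (z t) == n)))%N%:R
     <= C * (2 `^ s) ^+ n) ->
  (forall N, exists n t, [/\ (N <= n)%N, D t & z t = strcode (prefix_of X n)]) ->
  s < s' -> exists2 t, s < t < s' & galeset X t.
Proof.
move=> cD cz C0 s0 Dk DX ss'; set k := 2 `^ s in Dk.
have k1 : 1 <= k by rewrite /k -[leLHS](powRr0 2) ler_powR // ler1n.
have pmono (u v : R) : (2 : R) `^ u < 2 `^ v -> u < v.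
  move=> huv; rewrite ltNge; apply/negP => vu; move: huv; rewrite ltNge.
  by rewrite ler_powR // ler1n.
have kk' : k < 2 `^ s'.
  rewrite /k /powR gt_eqF // ltr_expR ltr_pM2r // ln_gt0 //.
  by rewrite ltr1n.
(* Choose rationals k < b < 2^s' and 1/b < c < 1/k. Then c k < 1 keeps the total mass finite, while
   b c > 1 makes the capital (b c)^n at a charged prefix unbounded. *)
have [x [y [x0 y0 /andP[kb bk']]]] : exists x y : nat,
    [/\ (0 < x)%N, (0 < y)%N & k < x%:R / y%:R < 2 `^ s'].
  by apply: posrat_between; rewrite kk' andbT; lra.
set b : R := x%:R / y%:R in kb bk'.
have b0 : 0 < b by lra.
have [g [h [g0 h0 /andP[bg gk]]]] : exists g h : nat,
    [/\ (0 < g)%N, (0 < h)%N & b^-1 < g%:R / h%:R < k^-1].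
  by apply: posrat_between; rewrite invr_ge0 ltW //= ltf_pV2 // posrE; lra.
set c : R := g%:R / h%:R in bg gk.
have c0 : 0 < c by apply: lt_trans bg; rewrite invr_gt0.
have ck : c * k < 1 by rewrite -ltr_pdivlMr ?mul1r //; lra.
have bc : 1 < b * c by rewrite -ltr_pdivrMl // mulr1.
have [t bE] := exists_log2 b0.
have mumeas t' : bitmeasure (dirac_weight c t') by apply: bitmeasure_dirac; exact: ltW.
have [m mmeas mE] := bitmeasure_series mumeas
  (fun N => sum_dirac_root N C0 (le_trans ler01 k1) (ltW c0) ck Dk).
exists t; first by apply/andP; split; apply: pmono; rewrite bE.
exists (fun w => b ^+ size w * m w); split.
- by rewrite -bE; exact: bitmeasure_gale.
- exact: (lower_semicomputable_dirac cD cz x0 y0 h0 mE).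
apply/succeedsP => B; have [n0 nB] := expr_unbounded B bc.
have [n [i [nn Di zi]]] := DX n0; exists n; apply: lt_le_trans (nB n nn) _.
rewrite size_prefix_of exprMn ler_wpM2l ?exprn_ge0 ?(ltW b0) //.
rewrite leNgt; apply/negP => mc.
suff : m (prefix_of X n) < m (prefix_of X n) by rewrite ltxx.
apply/mE; exists i.+1; apply: lt_le_trans mc _.
rewrite big_ord_recr /= ler_wpDl //.
  by apply: sumr_ge0 => j _; have [] := mumeas j.
rewrite /dirac_weight /hit Di zi log_strcode mulnK ?expn_gt0 // eqxx.
by rewrite size_prefix_of mul1r.
Qed.

End Dirac.

(** For s < 0 an s-gale never exceeds its initial capital. *)
Lemma galeset_lb0 (X : cantor_space) s : galeset X s -> 0 <= s.
Proof.
move=> [d [gd _ /succeedsP sd]]; rewrite leNgt; apply/negP => s0.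
have [n] := sd (d [::]); rewrite ltNge => /negP; apply.
have := bitmeasure_le_root (prefix_of X n) (gale_bitmeasure gd).
rewrite expr0 divr1 ler_pdivrMr ?exprn_gt0 ?powR_gt0 // => /le_trans; apply.
have [d0 _] := gd; rewrite ler_piMr // exprn_ile1 ?powR_ge0 //.
by rewrite -[leRHS](powRr0 2) ler_powR ?ler1n // ltW.
Qed.

End Cover.

(** * A universal cover *)

Section Counting.
Local Open Scope nat_scope.

Lemma sum_le_size (T : eqType) (P : nat -> bool) N (f : nat -> T) (s : seq T) :
  (forall t, P t -> f t \in s) ->
  (forall t u, P t -> P u -> f t = f u -> t = u) ->
  \sum_(t < N) P t <= size s.
Proof.
move=> Ps Pinj.
have -> : \sum_(t < N) P t = size [seq t <- iota 0 N | P t].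
  rewrite -(big_mkord xpredT (fun t => P t : nat)) /index_iota subn0 size_filter.
  by rewrite -sum1_count [in RHS]big_mkcond; apply: eq_bigr => i _; case: (P i).
rewrite -(size_map f); apply: uniq_leq_size.
  rewrite map_inj_in_uniq ?filter_uniq ?iota_uniq // => t u.
  by rewrite !mem_filter => /andP[+ _] /andP[+ _]; exact: Pinj.
by move=> _ /mapP[t + ->]; rewrite mem_filter => /andP[/Ps].
Qed.

Fixpoint strings n : seq (seq bool) :=
  if n is n'.+1 then
    [seq rcons w false | w <- strings n'] ++ [seq rcons w true | w <- strings n']
  else [:: [::]].

Lemma mem_strings w : w \in strings (size w).
Proof.
elim/last_ind: w => [//|w b IH]; rewrite size_rcons /= mem_cat.
by case: b; [apply/orP; right|apply/orP; left]; apply/mapP; exists w.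
Qed.

Lemma strcode_surj x : 0 < x -> exists w, strcode w = x.
Proof.
elim/ltn_ind: x => x IH x0; case: (ltnP 1 x) => [x1|x1].
  have [||w wE] := IH x./2; [lia|lia|].
  by exists (rcons w (odd x)); rewrite strcode_rcons wE; lia.
by exists [::]; rewrite /strcode /=; lia.
Qed.

(** A number x and its unique halting time m give the position <x, m> of x in the enumeration by
    e. *)
Definition rank e n t :=
  \sum_(j < t) (halts_at e (nfst j) (nsnd j) && (trunc_log 2 (nfst j) == n)).

Lemma rank_lt e n t u : t < u -> halts_at e (nfst t) (nsnd t) ->
  trunc_log 2 (nfst t) = n -> rank e n t < rank e n u.
Proof.
move=> tu ht lt.
have : rank e n t.+1 = rank e n t + 1 by rewrite /rank big_ord_recr /= ht lt eqxx.
rewrite addn1 => <-; rewrite /rank -(subnKC tu) big_split_ord /=.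
exact: leq_addr.
Qed.

(* The triple t = <e, <x, m>> says that the number x of length n >= e is      *)
(* enumerated at stage m by the program e, among its first (p / q) ^ n        *)
(* elements of length n.                                                      *)
Definition univ_cover (p q t : nat) : bool :=
  let n := trunc_log 2 (nfst (nsnd t)) in
  [&& nfst t <= n, halts_at (nfst t) (nfst (nsnd t)) (nsnd (nsnd t))
    & rank (nfst t) n (nsnd t) * q ^ n < p ^ n].

Lemma computable_univ_cover p q : computable (univ_cover p q).
Proof.
rewrite /univ_cover.
have cr f n k : computable f -> computable n -> computable k ->
    computable (fun t => rank (f t) (n t) (k t)).
  move=> cf cn ck.
  pose F t j := (halts_at (f t) (nfst j) (nsnd j) && (trunc_log 2 (nfst j) == n t) : nat).
  apply: (@computable_sum F) => //; rewrite /F.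
  have c1 : computable (fun u => halts_at (f (nfst u)) (nfst (nsnd u)) (nsnd (nsnd u))).
    by apply: computable_halts_at; [apply: (computable_comp cf)| |]; computability.
  have c2 : computable (fun u => n (nfst u)) by apply: (computable_comp cn); computability.
  by computability.
have c1 : computable (fun t => rank (nfst t) (trunc_log 2 (nfst (nsnd t))) (nsnd t)).
  by apply: cr; computability.
have c2 : computable (fun t => halts_at (nfst t) (nfst (nsnd t)) (nsnd (nsnd t))).
  by apply: computable_halts_at; computability.
by computability.
Qed.

(** On triples of length n the map to (program, rank) is injective, with at most n + 1 programs and
    ranks up to (p / q)^n. *)
Lemma univ_cover_count p q n N : 0 < q ->
  \sum_(t < N) (univ_cover p q t && (trunc_log 2 (nfst (nsnd t)) == n))
    <= n.+1 * (p ^ n %/ q ^ n).+1.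
Proof.
move=> q0; set K := (p ^ n %/ q ^ n).+1.
pose f t := (nfst t, rank (nfst t) n (nsnd t)).
apply: leq_trans (_ : size (allpairs pair (iota 0 n.+1) (iota 0 K)) <= _); last first.
  by rewrite size_allpairs !size_iota.
pose P t := univ_cover p q t && (trunc_log 2 (nfst (nsnd t)) == n).
apply: (@sum_le_size _ P N f).
  move=> t /andP[/and3P[le h r] /eqP ln]; rewrite ln in le r.
  apply/allpairsP; exists (f t); split=> //; rewrite mem_iota add0n //.
  by rewrite /K /= ltnS leq_divRL ?expn_gt0 ?q0 // ltnW.
move=> t u /andP[/and3P[_ ht _] /eqP lt] /andP[/and3P[_ hu _] /eqP lu] [e12 er].
rewrite -(npairK t) -(npairK u) -e12; congr npair.
rewrite -e12 in er hu; case: (ltngtP (nsnd t) (nsnd u)) => // tu.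
  by have := rank_lt tu ht lt; rewrite er ltnn.
by have := rank_lt tu hu lu; rewrite er ltnn.
Qed.

(** Halting times are unique, so distinct positions carry distinct strings. Positivity of n excludes
    the number 0, whose truncated logarithm is 0 but which codes no string. *)
Lemma rank_le_size e n t (Q : seq bool -> bool) : 0 < n ->
  (forall w m, halts_at e (strcode w) m -> Q w) ->
  rank e n t <= size [seq w <- strings n | Q w].
Proof.
move=> n0 hQ; rewrite -(size_map strcode).
pose P j := halts_at e (nfst j) (nsnd j) && (trunc_log 2 (nfst j) == n).
apply: (@sum_le_size _ P t nfst).
  move=> j /andP[hj /eqP lj].
  have [|w wE] := @strcode_surj (nfst j).
    by case: (nfst j) lj n0 => //; rewrite trunc_log0 => <-.
  apply/mapP; exists w => //; rewrite mem_filter -lj -wE log_strcode mem_strings andbT.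
  by apply: (hQ w (nsnd j)); rewrite wE.
move=> j k /andP[hj _] /andP[hk _] ejk; rewrite -(npairK j) -(npairK k) ejk.
by rewrite ejk in hj; rewrite (halts_at_uniq hj hk).
Qed.

End Counting.

(** * Constructive dimension in terms of covered prefixes *)

Section Dimension.
Variable R : realType.
Local Open Scope ring_scope.
Local Open Scope classical_set_scope.
Implicit Types (X : cantor_space) (s : R).

(** Kraft's inequality for gales, in its exact form. *)
Lemma sum_strings s (d : seq bool -> R) n : gale s d ->
  \sum_(w <- strings n) d w = (2 `^ s) ^+ n * d [::].
Proof.
move=> [_ dD]; elim: n => [|n IH]; first by rewrite big_seq1 mul1r.
rewrite /= big_cat !big_map /= -big_split /=; under eq_bigr do rewrite -dD.
by rewrite -mulr_sumr IH exprS mulrA.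
Qed.

Lemma size_filter_le (T : Type) (r : seq T) (d : T -> R) : (forall x, 0 <= d x) ->
  (size [seq x <- r | 1 < d x])%:R <= \sum_(x <- r) d x.
Proof.
move=> d0; elim: r => [|x r IH]; first by rewrite big_nil.
rewrite big_cons /=; case: ifP => [dx|_]; last by rewrite (le_trans IH) // lerDr.
by rewrite /= -natr1 addrC lerD // ltW.
Qed.

Definition io_covered (p q : nat) X := forall N, exists n t,
  [/\ (N <= n)%N, univ_cover p q t & nfst (nsnd t) = strcode (prefix_of X n)].

(** At most 2^(s n) d(empty) strings of length n have d > 1, eventually fewer than (p / q)^n; the
    program enumerating them thus covers them all. *)
Lemma galeset_io_covered X s p q : (0 < q)%N ->
  galeset X s -> 2 `^ s < p%:R / q%:R -> io_covered p q X.
Proof.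
move=> q0 [d [gd [P ceP Pd] sd]] spq N.
have cf : computable (fun x => npair x (npair 1 0)) by computability.
have [e eP] := ce_halts_at (ce_preimage ceP cf).
have eE w : (exists m, halts_at e (strcode w) m) <-> 1 < d w.
  by rewrite -eP /= Pd divr1.
have k0 : 0 < (2 : R) `^ s by rewrite powR_gt0.
have r1 : 1 < p%:R / q%:R / 2 `^ s by rewrite ltr_pdivlMr ?mul1r.
have [n0 hn0] := expr_unbounded (d [::]) r1.
(* The length must admit the program e, absorb the initial capital (n0), and be positive for
   [rank_le_size]. *)
have [n nn dn] := unbounded_tail ((succeedsP d X).1 sd) 1 (maxn N (maxn e n0.+1)).
have [m hm] := (eE _).2 dn.
exists n, (npair e (npair (strcode (prefix_of X n)) m)).
rewrite /univ_cover /= !npairE log_strcode size_prefix_of.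
split=> //; first by lia.
rewrite hm /=; apply/andP; split; first by lia.
have rk : (rank e n (npair (strcode (prefix_of X n)) m)
    <= size [seq w <- strings n | (1 < d w)%R])%N.
  by apply: rank_le_size => [|w k hk]; [lia|apply/eE; exists k].
rewrite -(ltr_nat R) natrM !natrX -ltr_pdivlMr; last by rewrite exprn_gt0 // ltr0n.
rewrite -expr_div_n; apply: le_lt_trans (_ : (2 `^ s) ^+ n * d [::] < _).
  rewrite -(sum_strings n gd); apply: le_trans (size_filter_le _ _); last by case: gd.
  by rewrite ler_nat.
rewrite -ltr_pdivlMl ?exprn_gt0 // mulrC -expr_div_n; apply: hn0; lia.
Qed.

(** Absorbs the factor n + 1, the number of programs, into a slightly larger rate. *)
Lemma poly_exp_le (a b : R) : 1 <= a < b ->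
  exists2 C, 0 <= C & forall n, n.+1%:R * (a ^+ n + 1) <= C * b ^+ n.
Proof.
move=> /andP[a1 ab]; have a0 : 0 < a by lra.
have r1 : 1 < b / a by rewrite ltr_pdivlMr ?mul1r.
have rp : 0 < b / a - 1 by lra.
have ri : 0 < (b / a - 1)^-1 by rewrite invr_gt0.
exists (2 * (1 + (b / a - 1)^-1)); first by lra.
move=> n; have an : 1 <= a ^+ n by rewrite exprn_ege1.
have -> : b ^+ n = a ^+ n * (b / a) ^+ n by rewrite -exprMn mulrCA divff ?mulr1 ?gt_eqF.
have H : n.+1%:R <= (1 + (b / a - 1)^-1) * (b / a) ^+ n.
  apply: le_trans (_ : (1 + (b / a - 1)^-1) * (1 + (b / a - 1) * n%:R) <= _).
    rewrite mulrDl mul1r mulrDr mulrA mulVf ?gt_eqF // mulr1 mul1r -natr1.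
    have : 0 <= (b / a - 1) * n%:R by rewrite mulr_ge0 // ltW.
    lra.
  by rewrite ler_wpM2l ?bernoulli //; lra.
apply: le_trans (_ : n.+1%:R * (2 * a ^+ n) <= _).
  by rewrite ler_wpM2l //; lra.
set c := (b / a - 1)^-1 in H *; set r := b / a in H *.
have -> : 2 * (1 + c) * (a ^+ n * r ^+ n) = (1 + c) * r ^+ n * (2 * a ^+ n) by ring.
by rewrite ler_wpM2r //; lra.
Qed.

Lemma log2_between (a b : R) : 0 < a -> a < 2 `^ b ->
  exists2 t, t < b & a < 2 `^ t.
Proof.
move=> a0 ab; have m0 : 0 < (a + 2 `^ b) / 2 by lra.
have [t tE] := exists_log2 m0; exists t; last by rewrite tE; lra.
rewrite ltNge; apply/negP => bt.
have : (2 : R) `^ b <= 2 `^ t by rewrite ler_powR // ler1n.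
by rewrite tE; lra.
Qed.

Lemma powR2_lt (a b : R) : (2 `^ a < 2 `^ b) = (a < b).
Proof.
by rewrite /powR gt_eqF // ltr_expR ltr_pM2r // ln_gt0 // ltr1n.
Qed.

Lemma io_covered_galeset X s p q : (0 < q)%N -> 1 <= p%:R / q%:R :> R ->
  io_covered p q X -> p%:R / q%:R < 2 `^ s -> exists2 t, t < s & galeset X t.
Proof.
move=> q0 pq1 pqX pqs; have pq0 : 0 < p%:R / q%:R :> R by lra.
have [u us pqu] := log2_between pq0 pqs.
have u0 : 0 <= u.
  by rewrite leNgt -powR2_lt powRr0; apply/negP => ?; lra.
have [|C C0 CP] := @poly_exp_le (p%:R / q%:R) (2 `^ u); first by rewrite pq1.
have cz : computable (fun t => nfst (nsnd t)) by computability.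
have [||t /andP[_ ts] tX] := galeset_cover (X := X) (computable_univ_cover p q) cz C0 u0 _ _ us.
- move=> n N; apply: le_trans (CP n).
  apply: le_trans (_ : (n.+1 * (p ^ n %/ q ^ n).+1)%N%:R <= _).
    by rewrite ler_nat; exact: univ_cover_count.
  rewrite natrM ler_wpM2l // -natr1 lerD2r expr_div_n ler_pdivlMr; last first.
    by rewrite exprn_gt0 // ltr0n.
  by rewrite -!natrX -natrM ler_nat leq_divM.
- by move=> N; have [n [t [? ? ?]]] := pqX N; exists n, t.
by exists t.
Qed.

Lemma strcode_prefix_zeros X l n : (l <= n)%N ->
  (forall i, (l <= i < n)%N -> X i = false) ->
  strcode (prefix_of X n) = (strcode (prefix_of X l) * 2 ^ (n - l))%N.
Proof.
move=> /subnKC <-; elim: (n - l)%N => [|k IH] X0.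
  by rewrite addn0 subnn muln1.
rewrite addnS prefix_ofS X0; last by lia.
rewrite strcode_rcons IH; last by move=> i ?; apply: X0; lia.
by rewrite addn0 subSn ?leq_addr // expnS -mul2n mulnCA.
Qed.

(** Strings of length n that vanish after position r n number about 2^(r n), and they can be listed
    computably. *)
Lemma galeset_zeros X (r s : R) : 0 <= r < s ->
  (forall N, exists n l, [/\ (N <= n)%N, l%:R <= r * n%:R &
    forall i, (l <= i < n)%N -> X i = false]) ->
  exists2 t, t < s & galeset X t.
Proof.
move=> /andP[r0 rs] Xz.
have [p [q [p0 q0 /andP[rpq pqs]]]] := posrat_between (introT andP (conj r0 rs)).
(* The pair <code of v, k> stands for v followed by k zeros, subject to |v| <= (p / q) (|v| + k). *)
pose D t := (0 < nfst t)%N && (trunc_log 2 (nfst t) * q <= (trunc_log 2 (nfst t) + nsnd t) * p)%N.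
pose z t := (nfst t * 2 ^ nsnd t)%N.
have logz t : (0 < nfst t)%N -> trunc_log 2 (z t) = (trunc_log 2 (nfst t) + nsnd t)%N.
  move=> t0; rewrite /z; elim: (nsnd t) => [|k IH]; first by rewrite muln1 addn0.
  by rewrite expnS mulnCA trunc_logMp ?IH ?addnS // muln_gt0 t0 expn_gt0.
have cD : computable D by rewrite /D; computability.
have cz : computable z by rewrite /z; computability.
set u : R := p%:R / q%:R in rpq pqs; have u0 : 0 <= u by lra.
have [||t /andP[_ ts] tX] := galeset_cover (X := X) cD cz (ler0n R 2) u0 _ _ pqs.
- move=> n N; pose L := (n * p %/ q)%N.
  apply: le_trans (_ : (2 ^ L.+1)%N%:R <= _).
    rewrite ler_nat; apply: leq_trans (_ : size (iota 0 (2 ^ L.+1)) <= _)%N; last first.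
      by rewrite size_iota.
    pose P t := D t && (trunc_log 2 (z t) == n).
    apply: (@sum_le_size _ P N nfst).
      move=> t /andP[/andP[t0 tq]]; rewrite logz // => /eqP e; rewrite e in tq.
      rewrite mem_iota add0n /=; apply: (leq_trans (trunc_log_ltn (nfst t) (isT : 1 < 2)%N)).
      by rewrite leq_exp2l // ltnS leq_divRL.
    move=> t v /andP[/andP[t0 _]]; rewrite logz // => /eqP et /andP[/andP[v0 _]].
    rewrite logz // => /eqP; rewrite -et => + etv; rewrite etv => /addnI e.
    by rewrite -(npairK t) -(npairK v) etv e.
  rewrite expnS natrM ler_wpM2l // natrX -powR_mulrn // -powR_mulrn ?powR_ge0 //.
  rewrite -powRrM ler_powR ?ler1n // /u mulrAC ler_pdivlMr ?ltr0n //.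
  by rewrite -!natrM ler_nat (leq_trans (leq_divM _ _)) // mulnC.
- move=> N; have [n [l [Nn ln X0]]] := Xz N.
  have [ln'|nl] := leqP l n.
    exists n, (npair (strcode (prefix_of X l)) (n - l)).
    rewrite /D /z nfstE nsndE strcode_gt0 log_strcode size_prefix_of subnKC //=.
    split=> //; last by rewrite -strcode_prefix_zeros.
    rewrite -(ler_nat R) !natrM -ler_pdivlMr ?ltr0n // (le_trans ln) //.
    by rewrite mulrC -mulrA ler_wpM2l // ltW.
  exists n, (npair (strcode (prefix_of X n)) 0).
  rewrite /D /z nfstE nsndE strcode_gt0 log_strcode size_prefix_of addn0 muln1 /=.
  split=> //; rewrite -(ler_nat R) !natrM -ler_pdivlMr ?ltr0n //.
  apply: le_trans (_ : l%:R <= _); first by rewrite ler_nat ltnW.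
  by rewrite (le_trans ln) // mulrC -mulrA ler_wpM2l // ltW.
by exists t.
Qed.

(** Needed for [inf] to be a genuine infimum; empty runs of zeros give the rate 1. *)
Lemma galeset_neq0 X : @galeset R X !=set0.
Proof.
have [|N|t _ tX] := @galeset_zeros X 1 2; first by rewrite ler01 ltr1n.
  exists N, N; split=> //; first by rewrite mul1r.
  by move=> i /andP[Ni iN]; have := leq_trans iN Ni; rewrite ltnn.
by exists t.
Qed.

Lemma cdim_le X s t : galeset X t -> t <= s -> cdim R X <= s.
Proof.
move=> tX; apply: le_trans; apply: ge_inf => //.
by exists 0 => u; exact: galeset_lb0.
Qed.

Lemma cdim_lt X s : cdim R X < s -> exists2 t, t < s & galeset X t.
Proof.
move=> Xs; apply: contrapT => h; move: Xs; rewrite ltNge => /negP; apply.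
apply: lb_le_inf; first exact: galeset_neq0.
by move=> t tX; rewrite leNgt; apply/negP => ts; apply: h; exists t.
Qed.

(** Rational rates leave room on both sides: a rate strictly between 2^s and 2^(s + e) converts
    covers into gales of exponent below s + e. *)
Lemma cdim_leP X s : 0 <= s ->
  cdim R X <= s <-> forall p q, (0 < q)%N -> 2 `^ s < p%:R / q%:R -> io_covered p q X.
Proof.
move=> s0; split=> [Xs p q q0 spq|H].
  have pq0 : 0 < p%:R / q%:R :> R by apply: lt_trans spq; rewrite powR_gt0.
  have [u uE] := exists_log2 pq0.
  have [|t tu tX] := @cdim_lt X u.
    by apply: le_lt_trans Xs _; rewrite -powR2_lt uE.
  by apply: (galeset_io_covered q0 tX); rewrite -uE powR2_lt.
apply/ler_addgt0Pr => e e0.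
have se : 0 <= (2 : R) `^ s < 2 `^ (s + e) by rewrite powR_ge0 powR2_lt ltrDl.
have [p [q [p0 q0 /andP[spq pqe]]]] := posrat_between se.
have pq1 : 1 <= p%:R / q%:R :> R.
  by apply: le_trans (ltW spq); rewrite -[leLHS](powRr0 2) ler_powR // ler1n.
have [t tse tX] := io_covered_galeset q0 pq1 (H _ _ q0 spq) pqe.
by apply: cdim_le tX _; exact: ltW.
Qed.

Lemma cdim_geP X s :
  s <= cdim R X <-> forall p q, (0 < q)%N ->
    (1 : R) <= p%:R / q%:R < 2 `^ s -> ~ io_covered p q X.
Proof.
split=> [sX p q q0 /andP[pq1 pqs] pqX|H].
  have [t ts tX] := io_covered_galeset q0 pq1 pqX pqs.
  have := cdim_le tX (lexx t); lra.
rewrite leNgt; apply/negP => /cdim_lt[t ts tX].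
have t0 := galeset_lb0 tX.
have tse : 0 <= (2 : R) `^ t < 2 `^ s by rewrite powR_ge0 powR2_lt.
have [p [q [p0 q0 /andP[tpq pqs]]]] := posrat_between tse.
apply: (H p q q0) (galeset_io_covered q0 tX tpq); rewrite pqs andbT.
by apply: le_trans (ltW tpq); rewrite -[leLHS](powRr0 2) ler_powR // ler1n.
Qed.

End Dimension.

(** * The Borel hierarchy of the Cantor space *)

Section Topology.
Local Open Scope classical_set_scope.
Implicit Types (X Y : cantor_space).

Lemma eq_prefix_ofP X Y n :
  prefix_of X n = prefix_of Y n <-> forall i, (i < n)%N -> X i = Y i.
Proof.
split=> [XY i iltn|XY]; first by rewrite -(nth_mkseq false X iltn) -/(prefix_of X n) XY nth_mkseq.
apply: (@eq_from_nth _ false); rewrite !size_mkseq // => i iltn.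
by rewrite !nth_mkseq ?XY.
Qed.

Lemma prefix_of_leq X Y m n : (m <= n)%N ->
  prefix_of X n = prefix_of Y n -> prefix_of X m = prefix_of Y m.
Proof.
move=> mn /eq_prefix_ofP XY; apply/eq_prefix_ofP => i im; apply: XY.
exact: leq_trans mn.
Qed.

Lemma cantor_nbhsP X (A : set cantor_space) :
  nbhs X A <-> exists n, forall Y, prefix_of Y n = prefix_of X n -> A Y.
Proof.
split=> [|[n nA]]; last first.
  apply: (@filterS _ _ _ [set Y | prefix_of Y n = prefix_of X n]) => //.
  elim: n {nA} => [|n IH]; first by apply: (@filterS _ _ _ setT); [|exact: filterT].
  have Xn : nbhs X [set Y | Y n = X n].
    apply: (@proj_continuous nat (fun=> bool) n X [set X n]).
    by rewrite nbhs_principalE; exact/principal_filterP.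
  apply: filterS2 IH Xn => Y /= Yn YX.
  by rewrite !prefix_ofS Yn YX.
pose F := filter_from [set: nat] (fun n => [set Y | prefix_of Y n = prefix_of X n]).
have FF : Filter F.
  apply: filter_from_filter; first by exists 0%N.
  move=> m n _ _; exists (maxn m n) => // Y /= XY; split.
    by apply: prefix_of_leq XY; exact: leq_maxl.
  by apply: prefix_of_leq XY; exact: leq_maxr.
have FX : F --> X.
  apply/cvg_sup => i B /=; rewrite (@nbhsE (initial_topology (fun x : forall _ : nat, bool => x i))).
  move=> [_ [[C oC <-] CX] CB]; exists i.+1 => // Y /= XY; apply: CB => /=.
  by move: CX; rewrite /= (eq_prefix_ofP X Y i.+1).1.
by move=> /FX[n _ nA]; exists n => Y; exact: nA.
Qed.

Lemma cantor_openP (A : set cantor_space) :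
  open A <-> forall X, A X -> exists n, forall Y, prefix_of Y n = prefix_of X n -> A Y.
Proof.
rewrite openE; split=> [AA X /AA /cantor_nbhsP//|h X AX].
by apply/cantor_nbhsP; exact: h.
Qed.

Lemma cantor_continuous (f : cantor_space -> cantor_space) :
  (forall n X Y, prefix_of X n = prefix_of Y n -> prefix_of (f X) n = prefix_of (f Y) n) ->
  continuous f.
Proof.
move=> fP X A /cantor_nbhsP[n nA]; apply/cantor_nbhsP; exists n => Y YX.
by apply: nA; exact: fP.
Qed.

Lemma open_prefixes (Q : seq bool -> Prop) : open [set X | exists n, Q (prefix_of X n)].
Proof. by apply/cantor_openP => X [n Qn]; exists n => Y YX; exists n; rewrite YX. Qed.

Lemma open_prefix (Q : seq bool -> Prop) n : open [set X | Q (prefix_of X n)].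
Proof. by apply/cantor_openP => X Qn; exists n => Y /= ->. Qed.

Lemma boldSigma0_2_prefixes (Q : seq bool -> Prop) :
  boldSigma0 2 [set X | exists n, Q (prefix_of X n)].
Proof.
exists (fun n => [set X | Q (prefix_of X n)]) => [i /=|].
  exact: (open_prefix (fun w => ~ Q w)).
by apply/seteqP; split=> X /= [n]; [|move=> _]; exists n.
Qed.

Lemma boldSigma0_2_closed_union (Q : nat -> seq bool -> Prop) :
  boldSigma0 2 (~` [set X | forall i, exists n, Q i (prefix_of X n)]).
Proof.
exists (fun i => ~` [set X | exists n, Q i (prefix_of X n)]) => [i /=|].
  by rewrite setCK; exact: open_prefixes.
apply/seteqP; split=> X /= => [/existsNP[i]|[i _]]; first by exists i.
by move=> h /(_ i).
Qed.

Lemma boldSigma0_preimage n (f : cantor_space -> cantor_space) (A : set cantor_space) :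
  continuous f -> boldSigma0 n.+1 A -> boldSigma0 n.+1 (f @^-1` A).
Proof.
move=> cf; elim: n A => [|n IH] A.
  by move=> oA; apply: open_comp => // x _; exact: cf.
move=> [B BP ->]; exists (fun i => f @^-1` B i) => [i|].
  exact: (IH _ (BP i)).
by rewrite preimage_bigcup.
Qed.

Lemma unif_lightSigma0_bold n (A : nat -> set cantor_space) p :
  unif_lightSigma0 n.+1 A -> boldSigma0 n.+1 (A p).
Proof.
elim: n A p => [|n IH] A p.
  move=> [W _ WA]; rewrite (_ : A p = [set X | exists k, W (npair p (strcode (prefix_of X k)))]).
    exact: (@open_prefixes (fun w => W (npair p (strcode w)))).
  by apply/seteqP; split=> X /WA.
move=> [B uB AB]; exists (fun i => ~` B (npair p i)) => [i|]; last exact: AB.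
by rewrite setCK; exact: IH.
Qed.

Lemma lightSigma0_bold n A : lightSigma0 n.+1 A -> boldSigma0 n.+1 A.
Proof. exact: (@unif_lightSigma0_bold n (fun=> A) 0%N). Qed.

(** The negated formula is a universal Sigma^0_3 predicate with the code and the argument both equal
    to X. *)
Definition cantor_diagonal : set cantor_space := [set X | ~ exists i, forall j, exists k,
  X (npair i (npair j (strcode (prefix_of X k))))].

Lemma cantor_diagonal_Pi3 : boldPi0 3 cantor_diagonal.
Proof.
exists (fun i => [set X | forall j, exists k,
    X (npair i (npair j (strcode (prefix_of X k))))]) => [i|]; last first.
  apply/seteqP; split=> X /=; first by move=> /contrapT[i]; exists i.
  by move=> [i _ h]; apply; exists i.
exists (fun j => ~` [set X | exists k,
    X (npair i (npair j (strcode (prefix_of X k))))]) => [j|]; last first.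
  apply/seteqP; split=> X /= => [/existsNP[j]|[j _]]; first by exists j.
  by move=> h /(_ j).
rewrite /= setCK; apply/cantor_openP => X [k Xk].
(* Long enough to fix both the prefix of length k and the bit of X that it queries. *)
exists (maxn k (npair i (npair j (strcode (prefix_of X k)))).+1) => Y YX.
exists k; rewrite (prefix_of_leq (leq_maxl _ _) YX).
by rewrite ((eq_prefix_ofP Y X _).1 YX) // leq_max ltnSn orbT.
Qed.

Lemma boldSigma0_3_code (A : set cantor_space) : boldSigma0 3 A ->
  exists Y : cantor_space, forall X, A X <-> exists i, forall j, exists k,
    Y (npair i (npair j (strcode (prefix_of X k)))).
Proof.
move=> [B BP ->].
have /choice[C CP] i : exists C : nat -> set cantor_space,
    (forall j, open (~` C j)) /\ ~` B i = \bigcup_j C j.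
  by have [C ? ?] := BP i; exists C.
(* The bit of Y at <i, <j, code of w>> says that the cylinder of w lies in the open complement of C
   i j. *)
pose Y : cantor_space := fun u => `[< forall X k,
  strcode (prefix_of X k) = nsnd (nsnd u) -> ~ C (nfst u) (nfst (nsnd u)) X >].
exists Y => X; apply: (@iff_trans _ (exists i, forall j, ~ C i j X)).
  split=> [[i _ Bi]|[i h]]; exists i => //.
    by move=> j Cj; suff : (~` B i) X by []; rewrite (CP i).2; exists j.
  by apply: contrapT => nB; have : (~` B i) X by []; rewrite (CP i).2 => -[j _]; exact: h.
split=> [[i h]|[i h]]; exists i => j; last first.
  have [k] := h j; rewrite /Y nfstE nsndE nfstE nsndE => /asboolP; exact.
have [k kP] := (cantor_openP _).1 ((CP i).1 j) X (h j).
exists k; rewrite /Y nfstE nsndE nfstE nsndE; apply/asboolP => Z l /strcode_inj ZX.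
have lk : l = k by rewrite -(size_prefix_of Z l) ZX size_prefix_of.
by apply: kP; rewrite -lk ZX lk.
Qed.

Lemma cantor_diagonal_not_Sigma3 : ~ boldSigma0 3 cantor_diagonal.
Proof.
move=> /boldSigma0_3_code[Y YP]; have := YP Y; rewrite /cantor_diagonal /=.
set P := exists i, _; by move=> [h1 h2]; have nP : ~ P by [move=> p; exact: (h2 p p)];
  exact: nP (h1 nP).
Qed.

End Topology.

(** * The upper bound: level sets of dimension are Pi^0_3 *)

Section DimPi3.
Variable R : realType.
Local Open Scope ring_scope.
Local Open Scope classical_set_scope.

Definition covered p q w := exists2 t, univ_cover p q t & nfst (nsnd t) = strcode w.

Lemma io_coveredE p q X : io_covered p q X <->
  forall N, exists n, (N <= n)%N /\ covered p q (prefix_of X n).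
Proof.
split=> h N; first by have [n [t [Nn ? ?]]] := h N; exists n; split=> //; exists t.
by have [n [Nn [t ? ?]]] := h N; exists n, t.
Qed.

(** The complement is a countable union: dimension above alpha is witnessed by a rate above 2^alpha
    with no covered prefix past some N ([F]), dimension below alpha by a rate below 2^alpha with
    infinitely many ([G]). *)
Lemma DIM_Pi3 (alpha : R) : 0 <= alpha -> boldPi0 3 (DIM alpha).
Proof.
move=> a0.
pose above p q := (0 < q)%N /\ 2 `^ alpha < p%:R / q%:R.
pose below p q := (0 < q)%N /\ (1 : R) <= p%:R / q%:R < 2 `^ alpha.
pose F N p q := [set X | above p q /\ ~ exists n, (N <= n)%N /\ covered p q (prefix_of X n)].
pose G p q := [set X | below p q /\ io_covered p q X].
exists (fun i => if nfst i is N.+1 then F N (nfst (nsnd i)) (nsnd (nsnd i))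
                 else G (nfst (nsnd i)) (nsnd (nsnd i))) => [i|].
  case: (nfst i) => [|N]; move: (nfst (nsnd i)) (nsnd (nsnd i)) => p q.
    have -> : G p q = [set X | forall N, exists n, below p q /\
        ((N <= size (prefix_of X n))%N /\ covered p q (prefix_of X n))].
      apply/seteqP; split=> X /= => [[bpq /io_coveredE h] N|h].
        by have [n [? ?]] := h N; exists n; rewrite size_prefix_of.
      split; first by have [n []] := h 0%N.
      apply/io_coveredE => N; have [n [_ []]] := h N.
      by rewrite size_prefix_of; exists n.
    exact: (@boldSigma0_2_closed_union (fun N w => below p q /\
      ((N <= size w)%N /\ covered p q w))).
  have -> : ~` F N p q = [set X | exists n, above p q ->
      ((N <= size (prefix_of X n))%N /\ covered p q (prefix_of X n))].
    apply/seteqP; split=> X /=.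
      move=> /not_andP[h|/contrapT[n [? ?]]]; first by exists 0%N => /h.
      by exists n => _; rewrite size_prefix_of.
    by move=> [n hn] [/hn[]]; rewrite size_prefix_of => ? ? []; exists n.
  exact: (@boldSigma0_2_prefixes (fun w => above p q ->
      ((N <= size w)%N /\ covered p q w))).
apply/seteqP; split=> X; last first.
  move=> [i _] + XA; rewrite -XA in a0 above below F G *.
  case: (nfst i) => [|N]; move: (nfst (nsnd i)) (nsnd (nsnd i)) => p q.
    by move=> [[q0 pq]]; have /cdim_geP := lexx (cdim R X); apply.
  move=> [[q0 pq]]; apply.
  by have /(cdim_leP _ a0)/(_ p q q0 pq)/io_coveredE := lexx (cdim R X); apply.
move=> /= XA; apply: contrapT => h; apply: XA; apply/eqP; rewrite eq_le.
apply/andP; split.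
  apply/cdim_leP => // p q q0 pq; apply/io_coveredE => N.
  apply: contrapT => hN; apply: h; exists (npair N.+1 (npair p q)) => //.
  by rewrite !npairE; split.
apply/cdim_geP => // p q q0 pq pqX; apply: h; exists (npair 0 (npair p q)) => //.
by rewrite !npairE; split.
Qed.

End DimPi3.

(** * A normal form for Pi^0_3 sets *)

Section NormalForm.
Local Open Scope classical_set_scope.
Local Open Scope nat_scope.
Variable C : nat -> nat -> set cantor_space.
Hypothesis Cclosed : forall i j, open (~` C i j).

Definition cyl_in (w : seq bool) (O : set cantor_space) :=
  forall Y, prefix_of Y (size w) = w -> O Y.

(** How many initial sets C i 0, C i 1, ... the prefix w already refutes, up to |w|. Along X it is
    bounded exactly when X lies in some C i j. *)
Definition progress i w :=
  \sum_(j < size w) `[< forall k, k <= j -> cyl_in w (~` C i k) >].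

Definition fires i w := progress i (take (size w).-1 w) < progress i w.

(** If no i < |w| fires, [find] returns |w|, which also tends to infinity. *)
Definition first_fire w := find (fun i => fires i w) (iota 0 (size w)).

Lemma fires_prefix i X n :
  fires i (prefix_of X n.+1) = (progress i (prefix_of X n) < progress i (prefix_of X n.+1)).
Proof.
rewrite /fires size_prefix_of prefix_ofS -cats1 take_size_cat //.
by rewrite size_prefix_of.
Qed.

Lemma progress_nondecreasing i X m n : m <= n ->
  progress i (prefix_of X m) <= progress i (prefix_of X n).
Proof.
move=> mn; rewrite /progress !size_prefix_of -(subnKC mn) big_split_ord /=.
apply: leq_trans (leq_addr _ _); apply: leq_sum => j _.
case: asboolP => //= h; rewrite lt0b; apply/asboolP => k kj Y.
rewrite size_prefix_of => Yn; apply: (h k kj Y); rewrite size_prefix_of.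
exact: prefix_of_leq (leq_addr _ _) Yn.
Qed.

Lemma progress_bounded i j X : C i j X -> forall n, progress i (prefix_of X n) <= j.
Proof.
move=> CX n; rewrite /progress.
apply: (@leq_trans (\sum_(u < size (prefix_of X n)) (u < j))).
  apply: leq_sum => u _; case: asboolP => //= h; rewrite lt0b ltnNge.
  apply/negP => ju; apply: (h j ju X) => //; by rewrite size_prefix_of.
have [jn|nj] := leqP j (size (prefix_of X n)); first by rewrite sum_ltn.
apply: leq_trans (ltnW nj); rewrite -[leqRHS]muln1 -[X in _ <= X * _]card_ord.
by rewrite -sum_nat_const leq_sum // => u _; case: (u < j).
Qed.

Lemma progress_unbounded i X : (forall j, ~ C i j X) ->
  forall m, exists n, m <= progress i (prefix_of X n).
Proof.
move=> CX m.
have /choice[f fP] j : exists n, forall Y, prefix_of Y n = prefix_of X n -> ~ C i j Y.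
  exact: (cantor_openP _).1 (Cclosed i j) X (CX j).
pose N := maxn m (\max_(j < m) f j); exists N.
rewrite /progress size_prefix_of -(subnKC (leq_maxl m _ : m <= N)) big_split_ord /=.
apply: leq_trans (leq_addr _ _).
rewrite -[leqLHS]muln1 -[X in X * _ <= _]card_ord -sum_nat_const.
apply: leq_sum => j _; rewrite lt0b; apply/asboolP => k kj Y.
rewrite subnKC ?leq_maxl // size_prefix_of => YX; apply: (fP k Y).
apply: prefix_of_leq YX; apply: leq_trans (leq_maxr _ _).
have km : k < m by exact: leq_ltn_trans kj (ltn_ord j).
exact: (@leq_bigmax _ (fun j : 'I_m => f j) (Ordinal km)).
Qed.

(** Each bounded requirement fires finitely often, so the least firing index escapes to infinity; a
    requirement i with unbounded progress fires infinitely often and keeps that index at most i. *)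
Lemma first_fireP X : (forall i, exists j, C i j X) <->
  forall k, exists T, forall t, T <= t -> k <= first_fire (prefix_of X t).
Proof.
split=> [CX k|h i].
  have /choice[T TP] i : exists T, forall t, T < t -> ~ fires i (prefix_of X t).
    have [j CXj] := CX i.
    pose P v := `[< exists t, v = progress i (prefix_of X t) >].
    have exP : exists v, P v by exists (progress i (prefix_of X 0)); apply/asboolP; exists 0.
    have ubP v : P v -> v <= j by move=> /asboolP[t ->]; exact: progress_bounded.
    case: (ex_maxnP exP ubP) => v /asboolP[T ->] vmax; exists T => -[//|t] Tt.
    rewrite fires_prefix; apply/negP; rewrite -leqNgt.
    apply: leq_trans (progress_nondecreasing i X (Tt : T <= t)).
    by apply: vmax; apply/asboolP; exists t.+1.
  exists (maxn k (\max_(i < k) T i).+1) => t; rewrite geq_max => /andP[kt Tt].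
  rewrite leqNgt; apply/negP => gk.
  have hf : has (fun i => fires i (prefix_of X t)) (iota 0 (size (prefix_of X t))).
    rewrite has_find -/(first_fire _) size_iota size_prefix_of.
    exact: leq_trans gk kt.
  have := nth_find 0 hf; rewrite -/(first_fire _) nth_iota ?add0n; last first.
    by rewrite size_prefix_of; exact: leq_trans gk kt.
  apply: TP; apply: leq_ltn_trans Tt.
  exact: (@leq_bigmax _ (fun i : 'I_k => T i) (Ordinal gk)).
apply: contrapT => /forallNP CX; have [T TP] := h i.+1.
(* Past [maxn T i.+1] the index i is within the searched range and may not fire, so its progress
   would be frozen. *)
have [n hn] := progress_unbounded CX (progress i (prefix_of X (maxn T i.+1))).+1.
have nT : maxn T i.+1 <= n.
  rewrite leqNgt; apply/negP => /ltnW/(progress_nondecreasing i X).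
  by rewrite leqNgt hn.
suff : progress i (prefix_of X n) <= progress i (prefix_of X (maxn T i.+1)).
  by rewrite leqNgt hn.
rewrite -(subnKC nT); elim: (n - _) => [|d IH]; first by rewrite addn0.
apply: leq_trans IH; rewrite addnS leqNgt -fires_prefix; apply/negP => fi.
set t := (_ + d).+1 in fi; have Tt : T <= t.
  by rewrite /t ltnW // ltnS (leq_trans (leq_maxl T i.+1)) // leq_addr.
have it : i < t.
  by rewrite /t ltnS (leq_trans _ (leq_addr _ _)) // (leq_trans _ (leq_maxr _ _)).
have := TP t Tt; rewrite leqNgt => /negP; apply.
rewrite ltnS leqNgt; apply/negP => /(before_find 0).
by rewrite size_prefix_of nth_iota // add0n fi.
Qed.

End NormalForm.

(** * Greedy avoidance of gales *)

Section Greedy.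
Variable R : realType.
Local Open Scope ring_scope.
Local Open Scope classical_set_scope.

Lemma gale_exponent_uniq (s t : R) d : gale s d -> gale t d -> d [::] != 0 -> s = t.
Proof.
move=> [_ ds] [_ dt] d0.
have /(mulIf d0) e : 2 `^ s * d [::] = 2 `^ t * d [::] by rewrite ds dt.
by case: (ltgtP s t) => //; rewrite -powR2_lt e ltxx.
Qed.

Lemma gale_eq0 (s : R) d w : gale s d -> d [::] = 0 -> d w = 0.
Proof.
move=> gd d0; have [dn _] := gd; apply/eqP; rewrite eq_le dn andbT.
have := bitmeasure_le_root w (gale_bitmeasure gd).
by rewrite d0 mul0r ler_pdivrMr ?mul0r // exprn_gt0 // powR_gt0.
Qed.

Definition enumerates_below e (d : seq bool -> R) := forall w a b,
  (exists m, halts_at e (npair (strcode w) (npair a b)) m) <-> a%:R / b.+1%:R < d w.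

Lemma enumerates_below_uniq e d d' : (forall w, 0 <= d w) -> (forall w, 0 <= d' w) ->
  enumerates_below e d -> enumerates_below e d' -> d = d'.
Proof.
suff H f g : (forall w, 0 <= f w) -> enumerates_below e f -> enumerates_below e g ->
    forall w, ~ f w < g w.
  move=> d0 d0' ed ed'; apply/funext => w; apply/eqP.
  by case: ltgtP => // fg; exfalso; apply: H fg.
move=> f0 ef eg w fg.
have [x [y [_ y0 /andP[]]]] := posrat_between (introT andP (conj (f0 w) fg)).
rewrite -(prednK y0) => fx /(eg w x y.-1)/ef; rewrite ltNge ltW //.
Qed.

(** A program enumerates the rationals below at most one gale, and a nonzero gale determines its
    exponent. Hence the programs index countably many measures, and M is their weighted sum, with
    the choice of measures made classically. *)
Lemma dominating_measure : exists2 M : seq bool -> R, bitmeasure M &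
  forall s d, gale s d -> lower_semicomputable d ->
  exists2 K, 0 <= K & forall w, d w <= (2 `^ s) ^+ size w * (K * M w).
Proof.
pose Phi e mu := exists s d, [/\ gale s d, enumerates_below e d &
  mu = fun w => d w / (2 `^ s) ^+ size w].
have /choice[mu muP] e : exists mu : seq bool -> R,
    bitmeasure mu /\ ((exists nu, Phi e nu) -> Phi e mu).
  have [[nu nuP]|no] := pselect (exists nu, Phi e nu).
    exists nu; split=> //; have [s [d [gd _ ->]]] := nuP; exact: gale_bitmeasure.
  by exists (fun=> 0); split=> //; split=> // w; rewrite addr0.
(* The e-th term then has mass at most 2^-e; the added 1 guards against a zero mass. *)
pose c e := (2^-1) ^+ e / (1 + mu e [::]).
have mu0 e w : 0 <= mu e w by have [[]] := muP e.
have c0 e : 0 < c e.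
  by rewrite divr_gt0 ?exprn_gt0 ?invr_gt0 // ltr_wpDr.
have [|N|M Mmeas ME] := @bitmeasure_series R (fun e w => c e * mu e w) ((1 - 2^-1)^-1).
- move=> e; have [[_ mD] _] := muP e; split=> w; last by rewrite mD mulrDr.
  by rewrite mulr_ge0 // ltW.
- apply: le_trans (geometric_le N _); last by rewrite invr_ge0 ler0n invf_lt1 ?ltr1n.
  apply: ler_sum => e _; rewrite /c mulrAC ler_pdivrMr ?ltr_wpDr //.
  by rewrite ler_wpM2l ?exprn_ge0 ?invr_ge0 // lerDr.
exists M => // s d gd [P ceP Pd].
have [e eP] := ce_halts_at ceP.
have ed : enumerates_below e d by move=> w a b; rewrite -eP.
have [s' [d' [gd' ed' muE]]] : Phi e (mu e).
  by apply: (muP e).2; exists (fun w => d w / (2 `^ s) ^+ size w), s, d.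
have dd' : d' = d.
  by apply: (enumerates_below_uniq _ _ ed' ed); [case: gd'|case: gd].
rewrite {}dd' in gd' ed' muE.
have [d0|d0] := eqVneq (d [::]) 0.
  by exists 0 => // w; rewrite (gale_eq0 w gd d0) mul0r mulr0.
rewrite -(gale_exponent_uniq gd gd' d0) in muE.
exists (c e)^-1; first by rewrite invr_ge0 ltW.
move=> w; rewrite -ler_pdivrMl ?exprn_gt0 ?powR_gt0 // mulrC.
rewrite -[leLHS]/((fun w => d w / (2 `^ s) ^+ size w) w) -muE.
rewrite ler_pdivlMl // leNgt; apply/negP => Mc.
suff : M w < M w by rewrite ltxx.
apply/ME; exists e.+1; apply: lt_le_trans Mc _.
rewrite big_ord_recr /= lerDr sumr_ge0 // => i _.
by rewrite mulr_ge0 // ltW.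
Qed.

Variable M : seq bool -> R.
Hypothesis Mmeas : bitmeasure M.

Definition greedy_bit (b : bool) w : bool :=
  b && (M (rcons w true) < M (rcons w false)).

Fixpoint greedy_prefix (free : nat -> bool) n : seq bool :=
  if n is n'.+1 then
    rcons (greedy_prefix free n') (greedy_bit (free n') (greedy_prefix free n'))
  else [::].

Definition greedy free : cantor_space :=
  fun n => greedy_bit (free n) (greedy_prefix free n).

Lemma prefix_of_greedy free n : prefix_of (greedy free) n = greedy_prefix free n.
Proof. by elim: n => [//|n IH]; rewrite prefix_ofS IH. Qed.

Lemma eq_greedy_prefix free free' n : (forall i, (i < n)%N -> free i = free' i) ->
  greedy_prefix free n = greedy_prefix free' n.
Proof.
elim: n => [//|n IH] ff' /=; rewrite IH; last by move=> i ?; apply: ff'; lia.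
by rewrite ff'.
Qed.

Definition nfree (free : nat -> bool) n := (\sum_(i < n) free i)%N.

(** A free bit moves to the child of smaller measure, at most half; a forced bit cannot increase the
    measure. *)
Lemma measure_greedy free n : M (greedy_prefix free n) * 2 ^+ nfree free n <= M [::].
Proof.
have [M0 MD] := Mmeas; elim: n => [|n IH]; first by rewrite /nfree big_ord0 mulr1.
apply: le_trans IH; rewrite /nfree big_ord_recr /= -/(nfree free n) exprD.
rewrite mulrA [leLHS]mulrAC ler_wpM2r ?exprn_ge0 // [leRHS]MD.
set u := greedy_prefix free n; have := M0 (rcons u true); have := M0 (rcons u false).
rewrite /greedy_bit; case: (free n) => /=; last by rewrite mulr1; lra.
by case: ltP => /=; rewrite expr1; lra.
Qed.

Hypothesis Mdom : forall s d, gale s d -> lower_semicomputable d ->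
  exists2 K, 0 <= K & forall w, d w <= (2 `^ s) ^+ size w * (K * M w).

(** For t < r a t-gale is at most K 2^(t n) M(empty) / 2^(r n) for large n, hence bounded along the
    sequence. *)
Lemma cdim_greedy_ge free (r : R) :
  (exists N, forall n, (N <= n)%N -> r * n%:R <= (nfree free n)%:R) ->
  r <= cdim R (greedy free).
Proof.
move=> [N HN]; apply: lb_le_inf; first exact: galeset_neq0.
move=> t [d [gd ld /succeedsP sd]]; rewrite leNgt; apply/negP => tr.
have [K K0 dK] := Mdom gd ld.
have [n Nn] := unbounded_tail sd (K * M [::]) N; rewrite ltNge => /negP; apply.
apply: le_trans (dK _) _; rewrite mulrCA ler_wpM2l // size_prefix_of prefix_of_greedy.
apply: le_trans (measure_greedy free n); rewrite mulrC ler_wpM2l //; first by case: Mmeas.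
rewrite -!powR_mulrn ?powR_ge0 // -powRrM ler_powR ?ler1n //.
apply: le_trans (HN n Nn); rewrite ler_wpM2r //; exact: ltW.
Qed.

End Greedy.

(** * Blocks *)

Section Blocks.
Variable R : realType.
Local Open Scope ring_scope.
Local Open Scope classical_set_scope.

(** The ratio t + 2 of consecutive endpoints is unbounded, so earlier blocks become negligible at
    the end of a block. *)
Definition block t := (t.+1)`!.

Lemma blockS t : block t.+1 = (t.+2 * block t)%N.
Proof. by rewrite /block factS. Qed.

Lemma block_gt0 t : (0 < block t)%N.
Proof. exact: fact_gt0. Qed.

Lemma leq_block t : (t < block t)%N.
Proof. by elim: t => [//|t IH]; rewrite blockS; have := block_gt0 t; nia. Qed.

Lemma block_homo t u : (t <= u)%N -> (block t <= block u)%N.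
Proof.
move=> /subnKC <-; elim: (u - t)%N => [|k IH]; first by rewrite addn0.
by rewrite addnS blockS (leq_trans IH) // leq_pmull.
Qed.

Lemma block_ex T n : (block T <= n)%N ->
  exists2 t, (T <= t)%N & (block t <= n < block t.+1)%N.
Proof.
move=> Tn; pose P t := (block t <= n)%N.
have exP : exists t, P t by exists T.
have ubP t : P t -> (t <= n)%N.
  by apply: leq_trans; exact: ltnW (leq_block t).
case: (ex_maxnP exP ubP) => t Pt tmax; exists t; first exact: tmax.
by rewrite [X in X && _]Pt ltnNge; apply/negP => /tmax; rewrite ltnn.
Qed.

Lemma block_uniq n t u : (block t <= n < block t.+1)%N ->
  (block u <= n < block u.+1)%N -> t = u.
Proof.
suff H v w : (block v <= n < block v.+1)%N -> (block w <= n < block w.+1)%N -> ~ (v < w)%N.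
  by move=> ht hu; case: (ltngtP t u) => // h; exfalso; apply: H h.
move=> /andP[_ h1] /andP[h2 _] /block_homo h3; move: h1; rewrite ltnNge.
by rewrite (leq_trans h3).
Qed.

Variable rate : nat -> R.

Definition free n : bool :=
  `[< exists t, (block t <= n < block t.+1)%N /\ n%:R < rate t * (block t.+1)%:R >].

Lemma freeE t n : (block t <= n < block t.+1)%N ->
  free n = (n%:R < rate t * (block t.+1)%:R).
Proof.
move=> tn; apply/asboolP/idP => [[u [un]]|h]; last by exists t.
by rewrite (block_uniq tn un).
Qed.

Lemma nfree_block t n : (block t <= n <= block t.+1)%N ->
  (nfree free (block t))%:R + Num.min n%:R (rate t * (block t.+1)%:R) - (block t)%:R
    <= (nfree free n)%:R.
Proof.
move=> /andP[tn]; rewrite -(subnKC tn); elim: (n - block t)%N => [|k IH] nt.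
  by rewrite addn0 lerBlDr lerD2l ge_min lexx.
rewrite addnS in nt *; have := IH (ltnW nt).
rewrite /nfree [in X in _ -> _ <= X]big_ord_recr /= -!/(nfree free _).
rewrite [(nfree _ _ + _)%:R]natrD.
rewrite (@freeE t) ?leq_addr //.
rewrite -[(block t + k).+1%:R]natr1; set x : R := (block t + k)%:R; set y := rate t * _.
set u := (nfree _ _)%:R; set v := (nfree _ _)%:R.
by rewrite /Num.min; case: (ltP x y) => xy; case: (ltP (x + 1) y) => /=; lra.
Qed.

(** Free positions come first in a block, so the density is controlled by its value at block ends,
    where all earlier blocks cost at most the gap r - r'. *)
Lemma nfree_ge (r r' : R) T : r <= 1 -> r' < r ->
  (forall t, (T <= t)%N -> r <= rate t <= 1) ->
  exists N, forall n, (N <= n)%N -> r' * n%:R <= (nfree free n)%:R.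
Proof.
move=> r1 r'r rT; have [r'0|r'0] := ltP r' 0.
  exists 0%N => n _; apply: le_trans (_ : 0 <= _); last by rewrite ler0n.
  by rewrite mulr_le0_ge0 // ltW.
have e0 : 0 < r - r' by lra.
pose T' := maxn T (Num.bound (r - r')^-1).
have bT t : (T' <= t)%N -> (block t)%:R <= (r - r') * (block t.+1)%:R.
  move=> tT; rewrite blockS natrM mulrA ler_peMl ?ler0n //.
  rewrite mulrC -ler_pdivrMr // mul1r.
  apply: le_trans (ltW (archi_boundP _)) _; first by rewrite invr_ge0 ltW.
  rewrite ler_nat; apply: leq_trans (_ : T' <= _)%N; first exact: leq_maxr.
  by rewrite (leq_trans tT) // !leqW.
have TT' : (T <= T')%N by exact: leq_maxl.
exists (block T'.+1) => n /block_ex[[//|t] Tt tn].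
have /andP[tn1 tn2] := tn.
have /andP[rt1 rt1'] : r <= rate t.+1 <= 1 by apply: rT; lia.
have /andP[rt0 rt0'] : r <= rate t <= 1 by apply: rT; lia.
have h1 : (nfree free (block t.+1))%:R + Num.min n%:R (rate t.+1 * (block t.+2)%:R)
    - (block t.+1)%:R <= (nfree free n)%:R by apply: nfree_block; rewrite tn1 ltnW.
have h0 : (nfree free (block t))%:R + Num.min (block t.+1)%:R (rate t * (block t.+1)%:R)
    - (block t)%:R <= (nfree free (block t.+1))%:R.
  by apply: nfree_block; rewrite block_homo //=.
have b1 := bT t Tt; have b2 := bT t.+1 (ltnW Tt).
have n1 : (block t.+1)%:R <= n%:R :> R by rewrite ler_nat.
have n2 : n%:R <= (block t.+2)%:R :> R by rewrite ler_nat ltnW.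
have f0 : 0 <= (nfree free (block t))%:R :> R by rewrite ler0n.
have f1 : 0 <= (nfree free (block t.+1))%:R :> R by rewrite ler0n.
have pb1 : 0 <= (block t.+1)%:R :> R by rewrite ler0n.
have q1 : r * (block t.+1)%:R <= rate t * (block t.+1)%:R by rewrite ler_wpM2r.
have q1' : rate t * (block t.+1)%:R <= (block t.+1)%:R by rewrite ler_piMl.
have q2 : r * (block t.+2)%:R <= rate t.+1 * (block t.+2)%:R by rewrite ler_wpM2r.
(* Inside the free part the count grows by 1 per position, faster than r' n; in the zero part it is
   already at least r' times the end of the block. *)
rewrite (min_idPr q1') in h0; case: (leP n%:R (rate t.+1 * (block t.+2)%:R)) h1 => hn h1.
  have : 0 <= (1 - r') * (n%:R - (block t.+1)%:R) by rewrite mulr_ge0 //; lra.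
  lra.
have : 0 <= r' * ((block t.+2)%:R - n%:R) by rewrite mulr_ge0 //; lra.
lra.
Qed.

Lemma cdim_le_rate (X : cantor_space) (r : R) : 0 < r ->
  (forall n, X n -> free n) ->
  (forall T, exists t, (T <= t)%N /\ rate t <= r) -> cdim R X <= r.
Proof.
move=> r0 Xfree rT; apply/ler_addgt0Pr => e e0.
have re : 0 <= r + e / 2 < r + e by lra.
have [N|t tre tX] := galeset_zeros (X := X) re _; last by apply: cdim_le tX _; exact: ltW.
pose B := maxn (Num.bound (r^-1)) (Num.bound (2 / e)).
have [t [Tt tr]] := rT (maxn N B).
(* All positions from l to the end of block t are zero. For large t, [block t] is below r times the
   endpoint and the rounding error 1 is below e / 2 times it. *)
exists (block t.+1), (maxn (block t) (Num.truncn (r * (block t.+1)%:R)).+1).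
have tb := leq_block t.+1.
have tB : (B <= t)%N by exact: leq_trans (leq_maxr _ _) Tt.
have tN : (N <= t)%N by exact: leq_trans (leq_maxl _ _) Tt.
have b0 : 0 <= (block t.+1)%:R :> R by rewrite ler0n.
split=> [||i]; first by lia.
  have [_|_] := leqP (block t) (Num.truncn (r * (block t.+1)%:R)).+1.
    rewrite -natr1; have : (Num.truncn (r * (block t.+1)%:R))%:R <= r * (block t.+1)%:R.
      by have /andP[] := truncn_itv (mulr_ge0 (ltW r0) b0).
    suff : 1 <= e / 2 * (block t.+1)%:R by lra.
    rewrite mulrC -ler_pdivrMr ?divr_gt0 // mul1r invf_div.
    apply: le_trans (ltW (archi_boundP _)) _; first by rewrite divr_ge0 // ltW.
    rewrite ler_nat; apply: leq_trans (leq_trans (leq_maxr _ _) tB) _.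
    exact: leq_trans (leqnSn t) (ltnW tb).
  apply: le_trans (_ : r * (block t.+1)%:R <= _); last by rewrite ler_wpM2r //; lra.
  rewrite blockS natrM mulrA ler_peMl ?ler0n // mulrC -ler_pdivrMr // mul1r.
  apply: le_trans (ltW (archi_boundP _)) _; first by rewrite invr_ge0 ltW.
  rewrite ler_nat; apply: leq_trans (leq_trans (leq_maxl _ _) tB) _.
  by rewrite !leqW.
rewrite geq_max -andbA => /and3P[ti ri it].
apply: contraTF isT => /Xfree; rewrite (@freeE t) ?ti // => ilt.
have : i%:R < r * (block t.+1)%:R by apply: lt_le_trans ilt _; rewrite ler_wpM2r.
rewrite ltNge => /negP; case; apply: ltW; apply: lt_le_trans (truncnS_gt _) _.
by rewrite ler_nat.
Qed.

End Blocks.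

(** * Hardness and conclusion *)

Section Main.
Variable R : realType.
Local Open Scope ring_scope.
Local Open Scope classical_set_scope.

Lemma boldPi0_3_normal_form (A : set cantor_space) : boldPi0 3 A ->
  exists g : seq bool -> nat, forall X, A X <->
    forall k, exists T, forall t, (T <= t)%N -> (k <= g (prefix_of X t))%N.
Proof.
move=> [B BP AB].
have /choice[C CP] i : exists C : nat -> set cantor_space,
    (forall j, open (~` C j)) /\ ~` B i = \bigcup_j C j.
  by have [C ? ?] := BP i; exists C.
exists (first_fire C) => X; rewrite -first_fireP; last by move=> i; have [] := CP i.
split=> [AX i|h].
  have : (~` B i) X by move=> Bi; have : (~` A) X by rewrite AB; exists i.
  by rewrite (CP i).2 => -[j _ Cj]; exists j.
apply: contrapT => nA; have : (~` A) X by [].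
rewrite AB => -[i _ Bi]; have [j Cj] := h i.
by have : (~` B i) X by rewrite (CP i).2; exists j.
Qed.

Lemma wadge_reducible_DIM (alpha : R) A : 0 < alpha < 1 -> boldPi0 3 A ->
  wadge_reducible A (DIM alpha).
Proof.
move=> /andP[a0 a1] /boldPi0_3_normal_form[g gP].
have [M Mmeas Mdom] := dominating_measure R.
(* Increasing to alpha without reaching it; [k.+2] keeps the values positive, as [cdim_le_rate]
   requires. *)
pose lev k : R := alpha * (1 - k.+2%:R^-1).
have inv_le k l : (k <= l)%N -> (l.+2%:R)^-1 <= (k.+2%:R)^-1 :> R.
  by move=> kl; rewrite lef_pV2 ?posrE ?ltr0n // ler_nat !ltnS.
have inv0 k : 0 < (k.+2%:R)^-1 :> R by rewrite invr_gt0 ltr0n.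
have inv1 k : (k.+2%:R)^-1 <= 2^-1 :> R by rewrite lef_pV2 ?posrE ?ltr0n // ler_nat.
have lev_mono k l : (k <= l)%N -> lev k <= lev l.
  by move=> /inv_le kl; rewrite /lev ler_pM2l // lerD2l lerN2.
have lev_lt k : lev k < alpha.
  by rewrite /lev gtr_pMr // gtrBl.
have lev_gt0 k : 0 < lev k by rewrite mulr_gt0 // subr_gt0 (le_lt_trans (inv1 k)) // invf_lt1 ?ltr1n.
pose rate X t := lev (g (prefix_of X t)).
pose f X := greedy M (free (rate X)).
exists f.
  apply: cantor_continuous => n X Y XY; rewrite !prefix_of_greedy.
  apply: eq_greedy_prefix => i ilt; apply: asbool_equiv_eq.
  (* The rate of block t reads only t bits of X, and t < [block t], so bit i of the image depends on
     fewer than i bits of X. *)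
  have rXY t : (block t <= i)%N -> rate X t = rate Y t.
    move=> ti; rewrite /rate (prefix_of_leq _ XY) //.
    by rewrite ltnW // (leq_trans (leq_block t)) // (leq_trans ti) // ltnW.
  by split=> -[t [ti h]]; exists t; split=> //; move: h; rewrite rXY //; case/andP: ti.
have frX X n : f X n -> free (rate X) n by move=> /andP[].
move=> X; rewrite gP /DIM /=; split=> [gk|fa].
  apply/eqP; rewrite eq_le; apply/andP; split.
    apply: (cdim_le_rate a0 (frX X)) => T; exists T; split=> //; exact: ltW (lev_lt _).
  apply/ler_addgt0Pl => e e0; rewrite addrC -lerBlDr.
  pose k := Num.bound (2 / e).
  have ke : alpha - e / 2 <= lev k.
    rewrite /lev mulrBr mulr1 lerD2l lerN2.
    apply: le_trans (_ : (k.+2%:R)^-1 <= _); first by rewrite ler_piMl // ltW.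
    rewrite -[leRHS]invrK lef_pV2 ?posrE ?invr_gt0 ?divr_gt0 ?ltr0n // invf_div.
    apply: le_trans (ltW (archi_boundP _)) _; first by rewrite divr_ge0 // ltW.
    by rewrite ler_nat -/k; lia.
  have [T Tk] := gk k.
  apply: (cdim_greedy_ge Mmeas Mdom); apply: (@nfree_ge R _ (alpha - e / 2) _ T); first by lra.
    by lra.
  move=> t /Tk/lev_mono; rewrite /rate => h; apply/andP; split; first by lra.
  by have := lev_lt (g (prefix_of X t)); lra.
move=> k; apply: contrapT => /forallNP h.
(* If g stays below k infinitely often, infinitely many rates are at most [lev k], which forces the
   dimension strictly under alpha. *)
suff : cdim R (f X) <= lev k by rewrite fa leNgt lev_lt.
apply: (cdim_le_rate (lev_gt0 k) (frX X)) => T.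
have /existsNP[t /not_implyP[Tt /negP]] := h T; rewrite -ltnNge => gk.
by exists t; split=> //; apply: lev_mono; exact: ltnW.
Qed.

End Main.

Local Open Scope ring_scope.

Theorem mainTheorem11 (R : realType) (alpha : R) (halpha : 0 < alpha < 1) :
  wadge_complete (@boldPi0 cantor_space 3) (DIM alpha) /\
  ~ @boldSigma0 cantor_space 3 (DIM alpha) /\
  ~ lightSigma0 3 (DIM alpha).
Proof.
have [a0 _] := andP halpha.
have red A : boldPi0 3 A -> wadge_reducible A (DIM alpha).
  exact: wadge_reducible_DIM.
have nS : ~ @boldSigma0 cantor_space 3 (DIM alpha).
  move=> S; have [f cf fP] := red _ cantor_diagonal_Pi3; apply: cantor_diagonal_not_Sigma3.
  rewrite (_ : cantor_diagonal = f @^-1` DIM alpha)%classic; last by apply/seteqP; split=> X /fP.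
  exact: boldSigma0_preimage.
split; first by split; [apply: DIM_Pi3; exact: ltW|].
by split=> // /lightSigma0_bold.
Qed.
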